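(* Let $\Gamma$ be either the free group on two free generators $s_1,s_2$, or $\Gamma=\mathbb{Z}\wr\mathbb{Z}=\langle s_1,s_2\mid [s_2^k s_1 s_2^{-k},s_1]=1\ \forall k\in\mathbb{Z}\rangle$, and let $I\subset\mathbb{N}$. Then the group $G_I$ has a recursive presentation if and only if $I$ is recursively enumerable, i.e. if and only if there is a Turing machine listing exactly all elements of $I$.
   Context: $\mathbb{N}=\{1,2,\dots\}$, $\mathbb{Z}_2=\mathbb{Z}/2\mathbb{Z}$. For $n\in\mathbb{N}$ put $t_n:=s_2^n s_1 s_2^{-n}\in\Gamma$ and $\Lambda_I:=\langle t_i\mid i\in I\rangle\le\Gamma$. Put $F_l:=\{s_1^{-1},e,s_1\}$ and let $V_{F_l,I}\subset\mathbb{Z}_2^{\oplus\Gamma}$ be the $\mathbb{Z}_2$-span of all $\mathbf 1_{gF_l}-\mathbf 1_{gtF_l}$ with $g\in\Gamma$, $t\in\Lambda_I$, where $\mathbf 1_X$ is the characteristic function of $X$. $\Gamma$ acts on $\mathbb{Z}_2^{\oplus\Gamma}$ by left translation, leaving $V_{F_l,I}$ invariant, and $G_I:=(\mathbb{Z}_2^{\oplus\Gamma}/V_{F_l,I})\rtimes\Gamma$. A recursive presentation is a presentation with finitely many generators whose set of relators can be listed by a Turing machine. *)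

(* Defs.v *)
From HB Require Import structures.
From mathcomp Require Import all_boot all_order all_algebra generic_quotient.
From mathcomp Require Import ring_quotient finmap boolp.
From mathcomp Require Import monalg.

Set Implicit Arguments.
Unset Strict Implicit.
Unset Printing Implicit Defensive.

Import GRing.Theory.

(* Turing machines as enumerators: one two-way infinite tape, deterministic  *)
(* transition table, and a write-only printer.  In each step the machine may *)
(* print a letter of the output alphabet A, or the mark that ends the word   *)
(* being printed.  The machine is started on the blank tape, and it lists a  *)
(* word w when it ends a word and the letters printed since the previous end *)
(* mark spell w.  It may run forever, and it may list a word repeatedly.     *)

Inductive direction := GoLeft | Stay | GoRight.

Inductive output (A : Type) := Silent | Print of A | EndWord.
Arguments Silent {A}.
Arguments EndWord {A}.

Record machine (A : finType) := Machine {
  state : finType;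
  symbol : finType;
  start : state;
  blank : symbol;
  (* None: the machine halts *)
  delta : state -> symbol -> option (state * symbol * direction * output A)
}.

Section Run.
Context {A : finType} (M : machine A).

(* The tape reads rev left ++ head :: right, with blanks on both sides. *)
Record config := Config {
  cstate : state M;
  cleft : seq (symbol M);
  chead : symbol M;
  cright : seq (symbol M);
  cword : seq A  (* letters printed since the last end mark *)
}.

Definition init_config : config :=
  Config (start M) [::] (blank M) [::] [::].

Definition move_head (d : direction) (l : seq (symbol M)) (a : symbol M)
    (r : seq (symbol M)) : seq (symbol M) * symbol M * seq (symbol M) :=
  match d with
  | GoLeft => (behead l, head (blank M) l, a :: r)
  | Stay => (l, a, r)
  | GoRight => (a :: l, head (blank M) r, behead r)
  end.

Definition step (c : config) : option config :=
  if delta (cstate c) (chead c) is Some (q, a, d, o) then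
    let: (l, h, r) := move_head d (cleft c) a (cright c) in
    Some (Config q l h r
      match o with
      | Silent => cword c
      | Print x => rcons (cword c) x
      | EndWord => [::]
      end)
  else None.

Definition run (n : nat) : option config := iter n (obind step) (Some init_config).

Definition lists (w : seq A) : Prop :=
  exists n c q a d,
    [/\ run n = Some c,
        delta (cstate c) (chead c) = Some (q, a, d, EndWord)
      & cword c = w].

End Run.

Definition listable (A : finType) (L : seq A -> Prop) : Prop :=
  exists M : machine A, forall w, lists M w <-> L w.

(* Natural numbers are printed in unary. *)
Definition recursively_enumerable (I : nat -> Prop) : Prop :=
  @listable unit (fun w => exists2 i, I i & w = nseq i tt).

(* Elements of the free group on n generators are represented by words, not  *)
(* necessarily reduced; the letter (i, false) is the i-th generator and      *)
(* (i, true) its inverse.                                                    *)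

Definition letter (n : nat) : finType := ('I_n * bool)%type.

Section Words.
Context {n : nat}.
Implicit Types (x : letter n) (u v w : seq (letter n)).

Definition linv x : letter n := (x.1, ~~ x.2).
Definition winv w : seq (letter n) := rev (map linv w).
Definition wcomm u v := winv u ++ winv v ++ u ++ v.
Definition wpow x (k : int) : seq (letter n) :=
  match k with Posz m => nseq m x | Negz m => nseq m.+1 (linv x) end.

(* w represents an element of the normal closure of R in the free group *)
Inductive normal_closure (R : seq (letter n) -> Prop) : seq (letter n) -> Prop :=
| nclosure_rel w : R w -> normal_closure R w
| nclosure_nil : normal_closure R [::]
| nclosure_cat u v :
    normal_closure R u -> normal_closure R v -> normal_closure R (u ++ v)
| nclosure_inv w : normal_closure R w -> normal_closure R (winv w)
| nclosure_conj u w :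
    normal_closure R w -> normal_closure R (u ++ w ++ winv u)
| nclosure_insert u v x :
    normal_closure R (u ++ v) -> normal_closure R (u ++ [:: x; linv x] ++ v)
| nclosure_cancel u v x :
    normal_closure R (u ++ [:: x; linv x] ++ v) -> normal_closure R (u ++ v).

Context {G : groupType}.

Definition leval (s : n.-tuple G) x : G :=
  (if x.2 then (tnth s x.1)^-1 else tnth s x.1)%g.
Definition weval (s : n.-tuple G) w : G := (\prod_(x <- w) leval s x)%g.

Definition presents (s : n.-tuple G) (R : seq (letter n) -> Prop) : Prop :=
  (forall g : G, exists w, weval s w = g) /\
  (forall w, weval s w = 1%g <-> normal_closure R w).

End Words.

Definition recursively_presented (G : groupType) : Prop :=
  exists (n : nat) (s : n.-tuple G) (R : seq (letter n) -> Prop),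
    listable R /\ presents s R.

Definition is_free2 (G : groupType) (s1 s2 : G) : Prop :=
  presents [tuple s1; s2] (fun=> False).

Definition wreath_relator (k : int) : seq (letter 2) :=
  let x1 : letter 2 := (ord0, false) in
  let x2 : letter 2 := (ord_max, false) in
  wcomm (wpow x2 k ++ [:: x1] ++ wpow x2 (- k)) [:: x1].

(* Z wr Z = < s1, s2 | [s2^k s1 s2^-k, s1] = 1 for all k in Z > *)
Definition is_ZwrZ (G : groupType) (s1 s2 : G) : Prop :=
  presents [tuple s1; s2] (fun w => exists k, w = wreath_relator k).

Inductive generated (G : groupType) (S : G -> Prop) : G -> Prop :=
| generated_in g : S g -> generated S g
| generated_1 : generated S 1%g
| generated_mul g h : generated S g -> generated S h -> generated S (g * h)%g
| generated_inv g : generated S g -> generated S (g^-1)%g.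

Definition lin_span (R : nzRingType) (M : lmodType R) (S : M -> Prop) (v : M) : Prop :=
  exists s : seq (R * M),
    (forall x, x \in s -> S x.2) /\ v = (\sum_(x <- s) x.1 *: x.2)%R.

Record zmod_action (G : groupType) (A : zmodType) := ZmodAction {
  zact :> G -> A -> A;
  zact1 : forall a, zact 1%g a = a;
  zactM : forall g h a, zact (g * h)%g a = zact g (zact h a);
  zactD : forall g a b, zact g (a + b)%R = (zact g a + zact g b)%R
}.

Section Semidirect.
Context {G : groupType} {A : zmodType}.

Definition semidirect (act : zmod_action G A) : Type := (A * G)%type.

Variable act : zmod_action G A.
Implicit Types p q : semidirect act.

HB.instance Definition _ := Choice.copy (semidirect act) (A * G)%type.

Definition sd_one : semidirect act := (0%R, 1%g).
Definition sd_mul p q : semidirect act :=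
  ((p.1 + act p.2 q.1)%R, (p.2 * q.2)%g).
Definition sd_inv p : semidirect act := ((- act (p.2^-1)%g p.1)%R, (p.2^-1)%g).

Lemma zact0 g : act g 0%R = 0%R.
Proof. by apply: (addIr (act g 0%R)); rewrite -zactD !add0r. Qed.

Lemma zactN g a : act g (- a)%R = (- act g a)%R.
Proof. by apply: (addIr (act g a)); rewrite -zactD !addNr zact0. Qed.

Lemma sd_mulA : associative sd_mul.
Proof.
move=> [a g] [b h] [c k].
by rewrite /sd_mul /= mulgA zactM zactD addrA.
Qed.

Lemma sd_mul1 : left_id sd_one sd_mul.
Proof. by move=> [a g]; rewrite /sd_mul /= add0r mul1g zact1. Qed.

Lemma sd_mulr1 : right_id sd_one sd_mul.
Proof. by move=> [a g]; rewrite /sd_mul /= zact0 addr0 mulg1. Qed.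

Lemma sd_mulV : left_inverse sd_one sd_inv sd_mul.
Proof. by move=> [a g]; rewrite /sd_mul /= addNr mulVg. Qed.

Lemma sd_mulrV : right_inverse sd_one sd_inv sd_mul.
Proof.
by move=> [a g]; rewrite /sd_mul /= zactN -zactM mulgV zact1 addrN.
Qed.

HB.instance Definition _ := isGroup.Build (semidirect act)
  sd_mulA sd_mul1 sd_mulr1 sd_mulV sd_mulrV.

End Semidirect.

(* {malg 'Z_2[Gamma]} is the group of finitely supported functions from      *)
(* Gamma to Z/2Z; only its Z/2Z-module structure is used.                    *)

Section GI.
Context {Gamma : groupType}.
Implicit Types (g h : Gamma) (u v : {malg 'Z_2[Gamma]}) (X : {fset Gamma}).

Definition indicator X : {malg 'Z_2[Gamma]} := [malg x in X => 1%R].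

Definition left_mul_set X g : {fset Gamma} := [fset (g * x)%g | x in X]%fset.

(* (g . v)(x) = v(g^-1 x) *)
Definition translate g v : {malg 'Z_2[Gamma]} :=
  [malg x in left_mul_set (msupp v) g => v@_(g^-1 * x)%g].

Lemma mem_left_mul_set X g x : (x \in left_mul_set X g) = ((g^-1 * x)%g \in X).
Proof.
apply/imfsetP/idP => /= [[y yX ->]|xX]; first by rewrite mulKg.
by exists (g^-1 * x)%g; rewrite ?mulVKg.
Qed.

Lemma indicatorE X x : ((indicator X)@_x = (x \in X)%:R)%R.
Proof. by rewrite mcoeffE; case: (x \in X). Qed.

Lemma translateE g v x : ((translate g v)@_x = v@_(g^-1 * x)%g)%R.
Proof. by rewrite mcoeffE mem_left_mul_set; case: msuppP. Qed.

Lemma translate1 v : translate 1%g v = v.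
Proof. by apply/malgP => x; rewrite translateE invg1 mul1g. Qed.

Lemma translateM g h v : translate (g * h)%g v = translate g (translate h v).
Proof. by apply/malgP => x; rewrite !translateE invgM mulgA. Qed.

Lemma translateD g u v : translate g (u + v)%R = (translate g u + translate g v)%R.
Proof. by apply/malgP => x; rewrite !(translateE, mcoeffD). Qed.

Lemma translate0 g : translate g 0%R = 0%R.
Proof. by apply/malgP => x; rewrite !(translateE, mcoeff0). Qed.

Lemma translateN g v : translate g (- v)%R = (- translate g v)%R.
Proof. by apply/malgP => x; rewrite !(translateE, mcoeffN). Qed.

Lemma translateZ g c v : translate g (c *: v)%R = (c *: translate g v)%R.
Proof. by apply/malgP => x; rewrite !(translateE, mcoeffZ). Qed.

Lemma translate_indicator g X : translate g (indicator X) = indicator (left_mul_set X g).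
Proof. by apply/malgP => x; rewrite translateE !indicatorE mem_left_mul_set. Qed.

Lemma left_mul_setM X g h : left_mul_set X (g * h)%g = left_mul_set (left_mul_set X h) g.
Proof. by apply/fsetP => x; rewrite !mem_left_mul_set invgM mulgA. Qed.

Variables (s1 s2 : Gamma) (I : nat -> Prop).

Definition conj_gen (n : nat) : Gamma := (s2 ^+ n * s1 * s2 ^- n)%g.

Definition Lambda : Gamma -> Prop := generated (fun t => exists2 i, I i & t = conj_gen i).

Definition Fl : {fset Gamma} := [fset (s1^-1)%g; 1%g; s1]%fset.

Definition V_FlI_gen v : Prop :=
  exists g t, Lambda t /\
    v = (indicator (left_mul_set Fl g) - indicator (left_mul_set Fl (g * t)%g))%R.

Definition V_FlI : {pred {malg 'Z_2[Gamma]}} := fun v => `[< lin_span V_FlI_gen v >].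

Lemma V_FlIP v : reflect (lin_span V_FlI_gen v) (v \in V_FlI).
Proof. exact: asboolP. Qed.

Lemma V_FlI_zmod_closed : zmod_closed V_FlI.
Proof.
split=> [|u v /V_FlIP[su [Su ->]] /V_FlIP[sv [Sv ->]]]; apply/V_FlIP.
  by exists [::]; rewrite big_nil.
exists (su ++ [seq ((- x.1)%R, x.2) | x <- sv]); split.
  move=> x; rewrite mem_cat => /orP[/Su //|/mapP[y /Sv Sy ->]] //.
rewrite big_cat big_map /= -sumrN; congr (_ + _)%R.
by apply: eq_bigr => x _; rewrite scaleNr.
Qed.

HB.instance Definition _ := GRing.isZmodClosed.Build _ V_FlI V_FlI_zmod_closed.

Lemma V_FlI_translate g v : v \in V_FlI -> translate g v \in V_FlI.
Proof.
move=> /V_FlIP[s [Ss ->]]; apply/V_FlIP.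
exists [seq (x.1, translate g x.2) | x <- s]; split.
  move=> _ /mapP[x /Ss [h [t [Lt def_x]]] ->] /=.
  exists (g * h)%g, t; split=> //.
  by rewrite def_x translateD translateN !translate_indicator -!left_mul_setM mulgA.
rewrite big_map /=; elim: s {Ss} => [|x s IHs]; first by rewrite !big_nil translate0.
by rewrite !big_cons translateD translateZ IHs.
Qed.

Local Open Scope quotient_scope.

Definition Vquot : zmodType := Quotient.quot V_FlI.

Definition Vquot_act g (a : Vquot) : Vquot :=
  \pi_(Quotient.quot V_FlI) (translate g (repr a)).

Lemma Vquot_act_pi g v :
  Vquot_act g (\pi_(Quotient.quot V_FlI) v) = \pi_(Quotient.quot V_FlI) (translate g v).
Proof.
apply/eqP; rewrite -Quotient.idealrBE -translateN -translateD.
by apply: V_FlI_translate; rewrite Quotient.idealrBE reprK.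
Qed.

Lemma Vquot_act1 a : Vquot_act 1%g a = a.
Proof. by rewrite /Vquot_act translate1 reprK. Qed.

Lemma Vquot_actM g h a : Vquot_act (g * h)%g a = Vquot_act g (Vquot_act h a).
Proof. by rewrite {1 3}/Vquot_act Vquot_act_pi translateM. Qed.

Lemma Vquot_actD g a b :
  Vquot_act g (a + b)%R = (Vquot_act g a + Vquot_act g b)%R.
Proof.
rewrite -{1}[a]reprK -{1}[b]reprK -raddfD Vquot_act_pi.
by rewrite translateD raddfD.
Qed.

Definition GI_action : zmod_action Gamma Vquot :=
  ZmodAction Vquot_act1 Vquot_actM Vquot_actD.

Definition GI : groupType := semidirect GI_action.

End GI.

Arguments GI {Gamma} s1 s2 I.

(* Main.v *)
Require Import Defs.
From HB Require Import structures.
From mathcomp Require Import all_boot all_algebra generic_quotient ring_quotient zify.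
From mathcomp Require Import finmap boolp monalg.

(* A Turing machine can enumerate all runs of a nondeterministic program acting
   on finitely many stacks; hence the set of outputs of such a program is
   listable, and nondeterministic programs suffice for both directions.

   Let b be the indicator function of F_l, viewed as an element of G_I. Then b
   commutes with t in Gamma iff 1_{F_l} - 1_{t F_l} lies in V, iff t lies in
   Lambda_I: right convolution with 1_{F_l} is injective on Z_2[Gamma], because
   s1 has infinite order, and modulo V the value of a finite sum of points on
   Lambda_I is well defined mod 2. Moreover t_n lies in Lambda_I iff n is in I,
   as one sees by letting Gamma act on Z x Z as on the lamps of Z wr Z. Hence I
   is enumerated by searching for those i for which [t_i, b] is a consequence
   of the listed relators of G_I.

   Conversely G_I is presented by a, s1, s2 subject to the relators of Gamma,
   a^2, all [z a z^-1, a] with z in Gamma, and the [t_i, b] with i in I, where b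
   is spelled s1^-1 a s1 a s1 a s1^-1. *)

Set Implicit Arguments.
Unset Strict Implicit.
Unset Printing Implicit Defensive.

(** * Stack machines on a Turing tape *)

(** Both directions need a search: guess a word, guess how long a listing machine runs, guess a
    chain of rewritings. Programs with [Fail], [Alt] and [Star] express such a search as a relation
    on stacks, so that their correctness involves no scheduling; dovetailing is done once and for
    all, by running a program on every finite string of choice bits.

    In the converse direction the hard half is that the relators suffice. The conjugate of b by g is
    the product of the lamps over g F_l, so a generator of V says that g and g t conjugate b to the
    same element, that is, that t commutes with b. The elements of Gamma commuting with b form a
    subgroup, so the relators [t_i, b] give this for all t in Lambda_I, and no relator has to
    mention g or a product of the t_i. This is what keeps the relators in a shape that one simple
    program can write: always the commutator of a conjugate z c z^-1 with a fixed word d. *)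

Section Systems.
Context {W : eqType}.

Section OneSystem.
Context {X : Type} (f : X -> X) (ev : X -> seq W).

Definition emits x w := exists n, w \in ev (iter n f x).

Fixpoint trace n x := if n is m.+1 then ev x ++ trace m (f x) else [::].

(* The flag records that at least one step is made. *)
Definition runs (b : bool) x y es := exists n, [/\ b <= n, y = iter n f x & es = trace n x].

Lemma trace_add m n x : trace (m + n) x = trace m x ++ trace n (iter m f x).
Proof.
elim: m x => //= m IHm x.
by rewrite IHm -iterS iterSr catA.
Qed.

Lemma trace_emits n x w : w \in trace n x -> emits x w.
Proof.
elim: n x => //= n IHn x; rewrite mem_cat => /orP[wx | /IHn[m wm]].
  by exists 0.
by exists m.+1; rewrite iterSr.
Qed.

Lemma mem_trace n i x w : i < n -> w \in ev (iter i f x) -> w \in trace n x.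
Proof.
elim: n i x => [|n IHn] [|i] x //= lt_in w_in; rewrite mem_cat ?w_in //.
by rewrite (IHn i) ?orbT // -iterSr.
Qed.

Lemma runs0 x : runs false x x [::].
Proof. by exists 0. Qed.

Lemma runs1 b x : runs b x (f x) (ev x).
Proof. by exists 1; rewrite /= cats0; case: b. Qed.

Lemma runsS b x y es : ev x = [::] -> runs false (f x) y es -> runs b x y es.
Proof.
by move=> evx [n [_ -> ->]]; exists n.+1; rewrite iterSr /= evx; case: b.
Qed.

Lemma runs_trans b b' y x z es es' :
  runs b x y es -> runs b' y z es' -> runs (b || b') x z (es ++ es').
Proof.
move=> [m [le_m -> ->]] [n [le_n -> ->]]; exists (m + n).
by rewrite trace_add -iterD addnC; split=> //; case: b b' le_m le_n => [] [] /=; lia.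
Qed.

Lemma runs_silentl b y x z es : runs false x y [::] -> runs b y z es -> runs b x z es.
Proof. exact: runs_trans. Qed.

Lemma runs_silentr b y x z es : runs b x y es -> runs false y z [::] -> runs b x z es.
Proof. by move=> xy /(runs_trans xy); rewrite orbF cats0. Qed.

End OneSystem.

Lemma emits_runs X (f : X -> X) (ev : X -> seq W) b x y w :
  runs f ev b x y [::] -> emits f ev x w <-> emits f ev y w.
Proof.
move=> [m [_ -> def_es]]; split=> -[n]; last by rewrite -iterD; exists (n + m).
have [lt_nm /(mem_trace lt_nm)| le_mn] := ltnP n m; first by rewrite -def_es.
by exists (n - m); rewrite -iterD subnK.
Qed.

(** The flag [true] makes each step of [f] cost at least one step of [g]. Hence an event of [g]
    either falls inside the first simulated step or is reached from [y'] in strictly fewer steps,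
    and strong induction applies. *)
Lemma simulation X Y (f : X -> X) (ev : X -> seq W) (g : Y -> Y) (ev' : Y -> seq W)
    (Sim : X -> Y -> Prop) x y w :
  (forall x y, Sim x y -> exists2 y', runs g ev' true y y' (ev x) & Sim (f x) y') ->
  Sim x y -> emits f ev x w <-> emits g ev' y w.
Proof.
move=> step Sxy; split=> -[n].
  elim: n x y Sxy => [|n IHn] x y /step[y' [m [_ def_y' def_ev]] Sfx].
    by rewrite /= def_ev; apply: trace_emits.
  rewrite iterSr => /(IHn _ _ Sfx)[i]; rewrite def_y' -iterD => w_in.
  by exists (i + m).
elim/ltn_ind: n x y Sxy => n IHn x y /step[y' [m [m_gt0 def_y' def_ev]] Sfx] w_in.
have [lt_nm | le_mn] := ltnP n m.
  by exists 0; rewrite /= def_ev; apply: mem_trace lt_nm w_in.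
have := IHn (n - m) _ _ _ Sfx; rewrite def_y' -iterD subnK //.
case=> // [|i w_i]; first by rewrite /= in m_gt0; lia.
by exists i.+1; rewrite iterSr.
Qed.

End Systems.

Definition upd {K : eqType} {T} (st : K -> T) (j : K) (x : T) : K -> T :=
  fun k => if k == j then x else st k.

Definition emit {A} (o : output A) (w : seq A) : seq A :=
  match o with Silent => w | Print x => rcons w x | EndWord => [::] end.

Lemma upd_id (K : eqType) (T : Type) (st : K -> T) j : upd st j (st j) = st.
Proof. by apply/funext => k; rewrite /upd; case: eqP => [->|]. Qed.

Lemma upd_same (K : eqType) (T : Type) (st : K -> T) j x : upd st j x j = x.
Proof. by rewrite /upd eqxx. Qed.

Lemma upd_upd (K : eqType) (T : Type) (st : K -> T) j x y : upd (upd st j x) j y = upd st j y.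
Proof. by apply/funext => k; rewrite /upd; case: eqP. Qed.

Section TotalMachine.
Context {A : finType} (M : machine A).
Implicit Types c : config M.

Definition tstep c : config M := odflt c (step c).
Definition tev c : seq (seq A) :=
  if delta (cstate c) (chead c) is Some (_, EndWord) then [:: cword c] else [::].

Lemma lists_emits (total : forall q a, delta (m := M) q a) w :
  lists M w <-> emits tstep tev (init_config M) w.
Proof.
have stepE c : step c = Some (tstep c).
  rewrite /tstep /step; case: (delta _ _) (total (cstate c) (chead c)) => // -[[[q a] d] o] _.
  by case: (move_head _ _ _ _) => -[].
have runE n : run M n = Some (iter n tstep (init_config M)).
  by elim: n => //= n; rewrite /run /= => ->; apply: stepE.
split=> [[n [c [q [a [d [rn dl cw]]]]]] | [n]].
  exists n; move: rn; rewrite runE => -[def_c].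
  by rewrite /tev def_c dl cw mem_seq1.
rewrite /tev; set c := iter n _ _.
case dl: (delta _ _) => [[[[q a] d] []]|] //; rewrite mem_seq1 => /eqP->.
by exists n, c, q, a, d; rewrite runE.
Qed.

(* The head of c stands on cell p of a tape whose cells to the left of cell 0
   are never visited. *)
Definition at_cell (q : state M) (p : nat) (T : nat -> symbol M) (w : seq A) c :=
  [/\ cstate c = q, size (cleft c) = p, cword c = w &
      forall i, nth (blank M) (rev (cleft c) ++ chead c :: cright c) i = T i].

Definition move_pos (d : direction) p :=
  match d with GoLeft => p.-1 | Stay => p | GoRight => p.+1 end.

Lemma at_cell_step q p T w c q' a d o :
  at_cell q p T w c -> delta (m := M) q (T p) = Some (q', a, d, o) ->
  (if d is GoLeft then 0 < p else true) ->
  at_cell q' (move_pos d p) (upd T p a) (emit o w) (tstep c)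
  /\ tev c = if o is EndWord then [:: w] else [::].
Proof.
case: c => qc l h r wc [/= <- <- <- defT].
have -> : T (size l) = h by rewrite -defT nth_cat size_rev ltnn subnn.
move=> dl lt_p; rewrite /tstep /step /tev /= dl; split; last by case: (o).
have updE i : nth (blank M) (rev l ++ a :: r) i = upd T (size l) a i.
  rewrite /upd -defT !nth_cat size_rev; case: (ltngtP i (size l)) => // [lt_i|->].
    by case def_i: (i - size l) => [|m] //; lia.
  by rewrite subnn.
case: d dl lt_p => /= dl lt_p; split=> //=.
- by rewrite size_behead.
- move=> i; rewrite -updE; case: l lt_p {defT updE dl} => //= b l _.
  by rewrite rev_cons -cats1 -catA.
- move=> i; rewrite -updE rev_cons -cats1 -catA /=.
  case: r {defT updE dl} => //=; rewrite !nth_cat /=.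
  case: ifP => // _; case: (i - size (rev l)) => [|[|k]] //=.
  by rewrite nth_nil.
Qed.

(** Lists with different trailing blanks describe the same tape, so tapes are compared as functions
    of the cell number, and [areach] quantifies over every concrete configuration that represents
    the abstract one. *)
Record acell := ACell {
  astate : state M; apos : nat; atape : nat -> symbol M; aword : seq A }.

Definition at_acell u c := at_cell (astate u) (apos u) (atape u) (aword u) c.

Definition areach b u v es :=
  forall c, at_acell u c -> exists2 c', runs tstep tev b c c' es & at_acell v c'.

Lemma areach0 u : areach false u u [::].
Proof. by move=> c uc; exists c => //; apply: runs0. Qed.

Lemma areach_silentl b v u z es :
  areach false u v [::] -> areach b v z es -> areach b u z es.
Proof.
move=> uv vz c /uv[c' cc' /vz[c'' cc'' zc]]; exists c'' => //.
exact: runs_silentl cc' cc''.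
Qed.

Lemma areach_silentr b v u z es :
  areach b u v es -> areach false v z [::] -> areach b u z es.
Proof.
move=> uv vz c /uv[c' cc' /vz[c'' cc'' zc]]; exists c'' => //.
exact: runs_silentr cc' cc''.
Qed.

Lemma areach1 b q p T w q' a d o :
  delta (m := M) q (T p) = Some (q', a, d, o) ->
  (if d is GoLeft then 0 < p else true) ->
  areach b (ACell q p T w) (ACell q' (move_pos d p) (upd T p a) (emit o w))
    (if o is EndWord then [:: w] else [::]).
Proof.
move=> dl lt_p c /at_cell_step/(_ dl lt_p)[c' evc]; exists (tstep c) => //.
by rewrite -evc; apply: runs1.
Qed.

End TotalMachine.
Arguments areach1 {A} M {b q p T w q' a d o}.

(** A pop on an empty stack passes [None] to the continuation and so doubles as an emptiness test.
    [IClear] serves to discard the remains of an abandoned computation. *)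
Inductive instr (K B Q A : Type) :=
| IPush of K & B & Q
| IPop of K & (option B -> Q)
| IClear of (pred K) & Q
| IOut of output A & Q.

Arguments IPush {K B Q A}.
Arguments IPop {K B Q A}.
Arguments IClear {K B Q A}.
Arguments IOut {K B Q A}.

(** * Compiling stacks into the tracks of one tape *)

Section StackMachine.
Context {K B Q A : finType} (code : Q -> instr K B Q A).

Definition sconf : Type := (Q * (K -> seq B) * seq A)%type.

Definition sstep (c : sconf) : sconf :=
  let: (q, st, w) := c in
  match code q with
  | IPush j b q' => (q', upd st j (b :: st j), w)
  | IPop j f => (f (ohead (st j)), upd st j (behead (st j)), w)
  | IClear P q' => (q', fun k => if P k then [::] else st k, w)
  | IOut o q' => (q', st, emit o w)
  end.

Definition sev (c : sconf) : seq (seq A) :=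
  let: (q, st, w) := c in if code q is IOut EndWord _ then [:: w] else [::].

Section Compile.
Variable q0 : Q.

(** The stacks are parallel tracks of one tape, with their bottoms in cell 0; the boolean marks cell
    0, so that the head finds its way home and never leaves to the left. *)
Definition cell : finType := (bool * {ffun K -> option B})%type.
Implicit Type c : cell.

Definition blank_cell : cell := (false, [ffun=> None]).

Definition set_cell c j (o : option B) : cell :=
  (c.1, [ffun k => if k == j then o else c.2 k]).

Definition clear_cell c (P : pred K) : cell :=
  (c.1, [ffun k => if P k then None else c.2 k]).

(* None marks the origin, Walk q executes the instruction of q, Take q erases
   the top of a stack, Ret q returns to the origin and then continues at q. *)
Definition tmstate : finType := option (Q + (Q + Q)).
Definition Walk q : tmstate := Some (inl q).
Definition Take q : tmstate := Some (inr (inl q)).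
Definition Ret q : tmstate := Some (inr (inr q)).

Definition tmdelta (q : tmstate) c : tmstate * cell * direction * output A :=
  match q with
  | None => (Walk q0, (true, c.2), Stay, Silent)
  | Some (inl q) =>
    match code q with
    | IPush j b q' =>
      if c.2 j is None then (Ret q', set_cell c j (Some b), Stay, Silent)
      else (Walk q, c, GoRight, Silent)
    | IPop j f =>
      if c.2 j is None then
        if c.1 then (Walk (f None), c, Stay, Silent) else (Take q, c, GoLeft, Silent)
      else (Walk q, c, GoRight, Silent)
    | IClear P q' =>
      if [forall k, P k ==> (c.2 k == None)] then (Ret q', c, Stay, Silent)
      else (Walk q, clear_cell c P, GoRight, Silent)
    | IOut o q' => (Walk q', c, Stay, o)
    end
  | Some (inr (inl q)) =>
    if code q is IPop j f then (Ret (f (c.2 j)), set_cell c j None, Stay, Silent)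
    else (Take q, c, Stay, Silent)
  | Some (inr (inr q)) =>
    if c.1 then (Walk q, c, Stay, Silent) else (Ret q, c, GoLeft, Silent)
  end.

Definition tm : machine A :=
  @Machine A tmstate cell None blank_cell (fun q c => Some (tmdelta q c)).

Definition tape (st : K -> seq B) (i : nat) : cell :=
  (i == 0, [ffun k => onth (rev (st k)) i]).

Lemma onth_None (T : Type) (s : seq T) i : onth s i = None <-> size s <= i.
Proof. by split=> [si | /onth_default //]; rewrite -onthNE si. Qed.

Lemma onth_lt (T : Type) (s : seq T) i : i < size s -> exists x, onth s i = Some x.
Proof. by rewrite -onthTE; case: (onth s i) => [x|] // _; exists x. Qed.

Local Notation ac q p T w := (@ACell A tm q p T w).

Lemma tape_return q T p w :
  (forall i, (T i).1 = (i == 0)) -> areach false (ac (Ret q) p T w) (ac (Walk q) 0 T w) [::].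
Proof.
move=> markT; elim: p => [|p IHp].
  rewrite -{2}(upd_id T 0).
  by apply: (areach1 tm (d := Stay) (o := Silent)); rewrite //= markT.
apply: areach_silentr IHp; rewrite -{2}(upd_id T p.+1).
by apply: (areach1 tm (d := GoLeft) (o := Silent)); rewrite //= markT.
Qed.

Arguments tape_return {q T p w}.

Lemma tape_walk q st j p w :
  (match code q with IPush k _ _ | IPop k _ => k = j | _ => False end) ->
  p <= size (st j) -> areach false (ac (Walk q) 0 (tape st) w) (ac (Walk q) p (tape st) w) [::].
Proof.
move=> codeq; elim: p => [_|p IHp lt_p]; first exact: areach0.
apply: areach_silentl (IHp (ltnW lt_p)) _.
rewrite -{2}(upd_id (tape st) p).
apply: (areach1 tm (d := GoRight) (o := Silent)); rewrite //=.
have [x xp] : exists x, onth (rev (st j)) p = Some x by apply: onth_lt; rewrite size_rev.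
by case: (code q) codeq => [k b q'|k f|P q'|o q'] // ->; rewrite ffunE xp.
Qed.

Lemma tape_push st j b : upd (tape st) (size (st j)) (set_cell (tape st (size (st j))) j (Some b))
  = tape (upd st j (b :: st j)).
Proof.
apply/funext => i; rewrite /upd /tape /set_cell; case: eqP => [->|ne_i]; congr pair.
  apply/ffunP => k; rewrite !ffunE; case: eqP => // _.
  by rewrite rev_cons -cats1 onth_cat size_rev ltnn subnn.
apply/ffunP => k; rewrite !ffunE; case: eqP => // ->.
rewrite rev_cons -cats1 onth_cat size_rev; case: ltnP => // le_i.
by rewrite !onth_default ?size_rev //=; lia.
Qed.

Lemma tape_pop st j x s : st j = x :: s ->
  upd (tape st) (size s) (set_cell (tape st (size s)) j None) = tape (upd st j s).
Proof.
move=> stj; apply/funext => i; rewrite /upd /tape /set_cell; case: eqP => [->|ne_i]; congr pair.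
  apply/ffunP => k; rewrite !ffunE; case: eqP => // _.
  by rewrite onth_default // size_rev.
apply/ffunP => k; rewrite !ffunE; case: eqP => // ->.
rewrite stj rev_cons -cats1 onth_cat size_rev; case: ltnP => // le_i.
by rewrite !onth_default ?size_rev //=; lia.
Qed.

Lemma tape_clear st P q q' w : code q = IClear P q' ->
  areach true (ac (Walk q) 0 (tape st) w)
    (ac (Walk q') 0 (tape (fun k => if P k then [::] else st k)) w) [::].
Proof.
move=> codeq; set st' := fun k => _.
(* The cells left of [p] are already cleared. The walk may stop before cell [n]: tracks have no
   gaps, so once all tracks in [P] are empty at one cell, they are empty from there on. *)
pose T p i := if i < p then tape st' i else tape st i.
have T0 : T 0 = tape st by apply/funext.
have TS p : upd (T p) p (clear_cell (T p p) P) = T p.+1.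
  apply/funext => i; rewrite /upd /T ltnn ltnS; case: ltngtP => // ->.
  congr pair; apply/ffunP => k; rewrite !ffunE /st'.
  by case: ifP => // _; rewrite onth0n.
have [n clearn] : exists n, forall k, P k -> size (st k) <= n.
  by exists (\sum_k size (st k)) => k _; rewrite (bigD1 k) //= leq_addr.
have walk m p : n = p + m -> areach true (ac (Walk q) p (T p) w) (ac (Walk q') 0 (tape st') w) [::].
  elim: m p => [|m IHm] p def_n.
    have -> : T p = tape st'.
      apply/funext => i; rewrite /T; case: ltnP => // le_i; congr pair.
      apply/ffunP => k; rewrite !ffunE /st'; case: ifP => // /clearn le_k.
      by rewrite onth0n onth_default // size_rev; lia.
    apply: areach_silentr (tape_return _) => //.
    rewrite -{2}(upd_id (tape st') p).
    apply: (areach1 tm (d := Stay) (o := Silent)); rewrite //= codeq.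
    case: forallP => // -[] k; apply/implyP => Pk.
    by rewrite ffunE /st' Pk onth0n.
  case: (boolP [forall k, P k ==> ((T p p).2 k == None)]) => [/forallP allN|notN]; last first.
    apply: areach_silentl (IHm p.+1 _); last by lia.
    by rewrite -TS; apply: (areach1 tm (d := GoRight) (o := Silent));
      rewrite //= codeq (negPf notN).
  have -> : tape st' = T p.
    apply/funext => i; rewrite /T; case: ltnP => // le_i; congr pair.
    apply/ffunP => k; rewrite !ffunE /st'; case: ifP => // Pk.
    have := allN k; rewrite Pk /T ltnn /= ffunE => /eqP/onth_None; rewrite size_rev => le_k.
    by rewrite onth0n onth_default // size_rev; lia.
  apply: areach_silentr (tape_return _); last first.
    by move=> i; rewrite /T; case: ifP.
  rewrite -{2}(upd_id (T p) p).
  apply: (areach1 tm (d := Stay) (o := Silent)); rewrite //= codeq.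
  by case: forallP.
by rewrite -T0; apply: (walk n).
Qed.

(** Each instruction starts and ends with the head on cell 0. A push walks to the first free cell of
    its track; a pop overshoots the top by one cell, hence the extra state [Take] one step back. *)
Lemma tm_simulates q st w :
  areach true (ac (Walk q) 0 (tape st) w)
    (let: (q', st', w') := sstep (q, st, w) in ac (Walk q') 0 (tape st') w')
    (sev (q, st, w)).
Proof.
case codeq: (code q) => [j b q' | j f | P q' | o q']; rewrite /= codeq.
- apply: (areach_silentl (@tape_walk q st j (size (st j)) w _ _)).
  + by rewrite codeq.
  + by [].
  apply: areach_silentr (tape_return _); last by [].
  rewrite -tape_push.
  apply: (areach1 tm (d := Stay) (o := Silent)); rewrite //= codeq ffunE.
  by rewrite onth_default // size_rev.
- apply: (areach_silentl (@tape_walk q st j (size (st j)) w _ _)).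
  + by rewrite codeq.
  + by [].
  case stj: (st j) => [|x s] /=.
    have -> : upd st j [::] = st by rewrite -stj upd_id.
    rewrite -{2}(upd_id (tape st) 0).
    by apply: (areach1 tm (d := Stay) (o := Silent)); rewrite //= codeq ffunE stj.
  apply: (areach_silentl (v := ac (Take q) (size s) (tape st) w)).
    rewrite -{2}(upd_id (tape st) (size s).+1).
    have nj : onth (rev (st j)) (size s).+1 = None by rewrite stj onth_default ?size_rev.
    by apply: (areach1 tm (d := GoLeft) (o := Silent)); move: nj; rewrite //= codeq ffunE => ->.
  apply: areach_silentr (tape_return _); last by [].
  rewrite -(tape_pop stj).
  apply: (areach1 tm (d := Stay) (o := Silent)); rewrite //= codeq ffunE stj.
  by rewrite rev_cons -cats1 onth_cat size_rev ltnn subnn.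
- exact: tape_clear.
- rewrite -{2}(upd_id (tape st) 0).
  by apply: (areach1 tm (d := Stay)); rewrite //= codeq.
Qed.

Lemma stack_machine_listable :
  listable (emits sstep sev (q0, fun=> [::], [::])).
Proof.
exists tm => w; rewrite lists_emits //.
(* The first step of the machine, from state [None], only writes the origin mark. *)
have [c init_c at_c] : exists2 c, runs (@tstep _ tm) (@tev _ tm) false (init_config tm) c [::] &
    at_acell (ac (Walk q0) 0 (tape (fun=> [::])) [::]) c.
  have -> : tape (fun=> [::]) = upd (fun=> blank_cell) 0 (true, [ffun=> None]).
    apply/funext => i; rewrite /tape /upd; case: eqP => _; congr pair;
      by apply/ffunP => k; rewrite !ffunE onth0n.
  apply: (areach1 tm (q := None) (d := Stay) (o := Silent) (T := fun=> blank_cell)) => //.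
  by split=> // -[|[|i]].
rewrite (emits_runs _ init_c); apply: iff_sym.
pose Sim (x : sconf) (c : config tm) :=
  let: (q, st, w) := x in at_acell (ac (Walk q) 0 (tape st) w) c.
apply: (simulation (Sim := Sim)) => [[[q st] v] c' /tm_simulates[c'' c'c'' at_c'']|//].
by exists c''; rewrite // /Sim; case: (sstep _) at_c'' => [[q' st'] v'].
Qed.

End Compile.
End StackMachine.

(** * Nondeterministic stack programs *)

Inductive star (T : Type) (R : T -> T -> Prop) (x : T) : T -> Prop :=
| star0 : star R x x
| starS y z : R x y -> star R y z -> star R x z.

Inductive prog (K B : Type) :=
| Skip
| Fail
| Push of K & B
| Pop of K & B
| Emp of K
| Seq of prog K B & prog K B
| Alt of prog K B & prog K B
| Star of prog K B.
Arguments Skip {K B}.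
Arguments Fail {K B}.
Arguments Emp {K B}.

(** Classical equality and choice on programs serve to form the finite type of subprograms, which
    become stack symbols. *)
HB.instance Definition _ (K B : Type) := gen_eqMixin (prog K B).
HB.instance Definition _ (K B : Type) := gen_choiceMixin (prog K B).

Section Denotation.
Context {K B : eqType}.
Implicit Types (e : prog K B) (st : K -> seq B).

Fixpoint den e st st' : Prop :=
  match e with
  | Skip => st' = st
  | Fail => False
  | Push j x => st' = upd st j (x :: st j)
  | Pop j x => exists2 s, st j = x :: s & st' = upd st j s
  | Emp j => st j = [::] /\ st' = st
  | Seq a b => exists2 st1, den a st st1 & den b st1 st'
  | Alt a b => den a st st' \/ den b st st'
  | Star a => star (den a) st st'
  end.

(* The bits of u resolve the choices; every step of the execution uses one,
   which bounds its length. *)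
Fixpoint exec (u : seq bool) (ctl : seq (prog K B)) st : option (K -> seq B) :=
  match u, ctl with
  | [::], [::] => Some st
  | c :: u', e :: ctl' =>
    match e with
    | Skip => exec u' ctl' st
    | Fail => None
    | Push j x => exec u' ctl' (upd st j (x :: st j))
    | Pop j x => if ohead (st j) == Some x then exec u' ctl' (upd st j (behead (st j))) else None
    | Emp j => if st j is [::] then exec u' ctl' st else None
    | Seq a b => exec u' [:: a, b & ctl'] st
    | Alt a b => exec u' ((if c then a else b) :: ctl') st
    | Star a => exec u' (if c then [:: a, e & ctl'] else ctl') st
    end
  | _, _ => None
  end.

Fixpoint dens (ctl : seq (prog K B)) st st' : Prop :=
  if ctl is e :: ctl' then exists2 st1, den e st st1 & dens ctl' st1 st' else st' = st.

Lemma exec_sound u ctl st st' : exec u ctl st = Some st' -> dens ctl st st'.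
Proof.
elim: u ctl st => [|c u IHu] [|e ctl] st //=; first by case.
case: e => [||j x|j x|j|a b|a b|a] //.
- by move=> /IHu; exists st.
- by move=> /IHu; exists (upd st j (x :: st j)).
- case: eqP => // def_x /IHu; exists (upd st j (behead (st j))) => //.
  by exists (behead (st j)) => //; case: (st j) def_x => //= y s [->].
- by case stj: (st j) => [|//] /IHu; exists st.
- by move=> /IHu[st1 den_a [st2 den_b den_ctl]]; exists st2 => //; exists st1.
- by move=> /IHu[st1 den_c den_ctl]; exists st1 => //=; case: c den_c; [left | right].
case: c => /IHu; last by exists st; first exact: star0.
by move=> [st1 den_a [st2 den_s den_ctl]]; exists st2; first apply: starS den_a _.
Qed.

(** The arbitrary continuation [ctl] lets the choice bits be built from back to front: those for
    what follows are given, and those for [e] are put before them. *)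
Lemma exec_complete e st st' ctl u st'' :
  den e st st' -> exec u ctl st' = Some st'' -> exists u', exec u' (e :: ctl) st = Some st''.
Proof.
elim: e st st' ctl u => [||j x|j x|j|a IHa b IHb|a IHa b IHb|a IHa] st st' ctl u //=.
- by move=> ->; exists (true :: u).
- by move=> ->; exists (true :: u).
- by move=> [s stj ->]; exists (true :: u) => /=; rewrite stj eqxx.
- by move=> [stj ->]; exists (true :: u) => /=; rewrite stj.
- by move=> [st1 /IHa a_ok /IHb/[apply]-[u1 /a_ok[u2 eu2]]]; exists (true :: u2).
- by case=> [/IHa | /IHb]/[apply]-[u' eu']; [exists (true :: u') | exists (false :: u')].
move=> den_s eu; elim: den_s eu => {st st'} [st|st st1 st2 /IHa a_ok _ IHs] eu.
  by exists (false :: u).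
by have [u1 /a_ok[u2 eu2]] := IHs eu; exists (true :: u2).
Qed.

Lemma denE e st st' : den e st st' <-> exists u, exec u [:: e] st = Some st'.
Proof.
split=> [den_e | [u /exec_sound[st1 den_e] /= -> //]].
exact: (exec_complete (u := [::]) (ctl := [::]) den_e).
Qed.

Fixpoint subs e : seq (prog K B) :=
  e :: match e with
       | Seq a b | Alt a b => subs a ++ subs b
       | Star a => subs a
       | _ => [::]
       end.

Definition children e : seq (prog K B) :=
  match e with Seq a b | Alt a b => [:: a; b] | Star a => [:: a] | _ => [::] end.

Lemma subs_refl e : e \in subs e.
Proof. by case: e => *; rewrite mem_head. Qed.

Lemma subsE e : subs e = e :: flatten [seq subs e' | e' <- children e].
Proof. by case: e => //= *; rewrite ?cats0. Qed.

(** Execution only puts subprograms and their children on the control stack, so this closure keeps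
    that stack inside a finite alphabet. *)
Lemma subs_children e e1 e2 : e1 \in subs e -> e2 \in children e1 -> e2 \in subs e.
Proof.
move=> + e21.
have step e' : (forall a, a \in children e' -> e1 \in subs a -> e2 \in subs a) ->
    e1 \in subs e' -> e2 \in subs e'.
  move=> IH; rewrite !(subsE e') !in_cons => /orP[/eqP def_e1 | /flatten_mapP[a ea a1]].
    by apply/orP; right; apply/flatten_mapP; exists e2; rewrite -?def_e1 ?subs_refl.
  by apply/orP; right; apply/flatten_mapP; exists a => //; apply: IH.
elim: e => [||j x|j x|j|a IHa b IHb|a IHa b IHb|a IHa]; apply: step => // c;
  rewrite ?mem_seq2 ?mem_seq1.
- by case/orP=> /eqP->.
- by case/orP=> /eqP->.
- by move=> /eqP->.
Qed.

End Denotation.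

(** * A deterministic stack machine trying all choice strings *)

Section Enumerate.
Context {K B A : finType} (e0 : prog K B) (out : K) (dec : B -> option A).

Definition node : finType := seq_sub (subs e0).

Definition node_of (n : node) (e : prog K B) : node := insubd n e.

Lemma val_node_of n e : e \in children (val n) -> val (node_of n e) = e.
Proof. by move=> e_n; rewrite insubdK //; apply: subs_children e_n; apply: valP. Qed.

Definition root : node := Sub e0 (subs_refl e0).

(** One round tries one bit string. [Exec] to [PushNode] follow [exec], moving each bit read to the
    stack [Used]; [Finish] to [OutputEnd] print the result of a success; [Reset] clears all stacks
    but the two that hold bits, [Restore] puts the bits back, and [Incr] passes to the next string.
    The flag of [Restore] tells whether the increment is still to come. *)
Inductive estate :=
| Start
| Exec
| Save of bool
| Control of bool
| Do of bool & node
| PushNode of node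
| Finish
| Output
| OutputSym of B
| OutputEnd
| Reset
| Restore of bool
| RestoreBit of bool & bool
| Incr
| IncrCarry.

Definition estate_code : finType :=
  ('I_8 + (bool + bool + bool * node) + (node + B) + (bool + bool * bool))%type.

Definition encode (q : estate) : estate_code :=
  let c k : estate_code := inl (inl (inl (inord k))) in
  match q with
  | Start => c 0
  | Exec => c 1
  | Save b => inl (inl (inr (inl (inl b))))
  | Control b => inl (inl (inr (inl (inr b))))
  | Do b n => inl (inl (inr (inr (b, n))))
  | PushNode n => inl (inr (inl n))
  | Finish => c 2
  | Output => c 3
  | OutputSym x => inl (inr (inr x))
  | OutputEnd => c 4
  | Reset => c 5
  | Restore r => inr (inl r)
  | RestoreBit r b => inr (inr (r, b))
  | Incr => c 6
  | IncrCarry => c 7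
  end.

Definition decode (c : estate_code) : estate :=
  match c with
  | inl (inl (inl i)) => nth Start [:: Start; Exec; Finish; Output; OutputEnd; Reset; Incr; IncrCarry] i
  | inl (inl (inr (inl (inl b)))) => Save b
  | inl (inl (inr (inl (inr b)))) => Control b
  | inl (inl (inr (inr (b, n)))) => Do b n
  | inl (inr (inl n)) => PushNode n
  | inl (inr (inr x)) => OutputSym x
  | inr (inl r) => Restore r
  | inr (inr (r, b)) => RestoreBit r b
  end.

Lemma encodeK : cancel encode decode.
Proof. by case=> *; rewrite /= ?inordK. Qed.

HB.instance Definition _ := Finite.copy estate (can_type encodeK).

Definition estack : finType := (K + option bool)%type.
Definition tagged_sym : finType := (B + (node + bool))%type.
Definition Ctl : estack := inr None.
Definition Bits : estack := inr (Some false).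
Definition Used : estack := inr (Some true).
Definition bit (b : bool) : tagged_sym := inr (inr b).
Definition nodesym (n : node) : tagged_sym := inr (inl n).

Definition ecode (q : estate) : instr estack tagged_sym estate A :=
  match q with
  | Start => IPush Ctl (nodesym root) Exec
  | Exec => IPop Bits (fun o => if o is Some (inr (inr b)) then Save b else Finish)
  | Save b => IPush Used (bit b) (Control b)
  | Control b => IPop Ctl (fun o => if o is Some (inr (inl n)) then Do b n else Reset)
  | Do b n =>
    match val n with
    | Skip => IOut Silent Exec
    | Fail => IOut Silent Reset
    | Push j x => IPush (inl j) (inl x) Exec
    | Pop j x => IPop (inl j) (fun o => if o == Some (inl x) then Exec else Reset)
    | Emp j => IPop (inl j) (fun o => if o is None then Exec else Reset)
    | Seq e1 e2 => IPush Ctl (nodesym (node_of n e2)) (PushNode (node_of n e1))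
    | Alt e1 e2 => IPush Ctl (nodesym (node_of n (if b then e1 else e2))) Exec
    | Star e1 => if b then IPush Ctl (nodesym n) (PushNode (node_of n e1))
                 else IOut Silent Exec
    end
  | PushNode n => IPush Ctl (nodesym n) Exec
  | Finish => IPop Ctl (fun o => if o is None then Output else Reset)
  | Output => IPop (inl out) (fun o => if o is Some (inl x) then OutputSym x else OutputEnd)
  | OutputSym x => IOut (if dec x is Some a then Print a else Silent) Output
  | OutputEnd => IOut EndWord Reset
  | Reset => IClear (fun k => if k is inr (Some _) then false else true) (Restore true)
  | Restore r => IPop Used (fun o =>
      if o is Some (inr (inr b)) then RestoreBit r b else if r then Incr else Start)
  | RestoreBit r b => IPush Bits (bit b) (Restore r)
  | Incr => IPop Bits (fun o => match o with
      | Some (inr (inr true)) => IncrCarry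
      | Some _ => RestoreBit false true
      | None => RestoreBit false false
      end)
  | IncrCarry => IPush Used (bit false) Incr
  end.

(* The successor in the enumeration of bit strings as bijective base 2
   numerals, least significant digit first. *)
Fixpoint incr (u : seq bool) : seq bool :=
  match u with
  | [::] => [:: false]
  | false :: u' => true :: u'
  | true :: u' => false :: incr u'
  end.

(** Two increments turn [false :: u] into [false :: incr u], so every tail is reached behind the
    digit [false], and one more increment makes that digit [true]. *)
Lemma incr_onto u : exists n, iter n incr [::] = u.
Proof.
elim: u => [|b u [n <-]]; first by exists 0.
have [m def_m] : exists m, iter m incr [::] = false :: iter n incr [::].
  elim: n => [|n [m def_m]]; first by exists 1.
  by exists m.+2; rewrite !iterS def_m.
by case: b; [exists m.+1; rewrite iterS def_m | exists m].
Qed.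

Definition stk (st : K -> seq B) (ctl : seq node) (u v : seq bool) : estack -> seq tagged_sym :=
  fun k => match k with
  | inl j => map inl (st j)
  | inr None => map nodesym ctl
  | inr (Some false) => map bit u
  | inr (Some true) => map bit v
  end.

Lemma upd_data st ctl u v j s : upd (stk st ctl u v) (inl j) (map inl s) = stk (upd st j s) ctl u v.
Proof.
apply/funext => -[k|k] //; rewrite /upd /=.
by have -> : (inl k == inl j :> estack) = (k == j) by []; case: eqP.
Qed.

Lemma upd_ctl st ctl u v s : upd (stk st ctl u v) Ctl (map nodesym s) = stk st s u v.
Proof. by apply/funext => -[k|[[]|]]. Qed.

Lemma upd_bits st ctl u v s : upd (stk st ctl u v) Bits (map bit s) = stk st ctl s v.
Proof. by apply/funext => -[k|[[]|]]. Qed.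

Lemma upd_used st ctl u v s : upd (stk st ctl u v) Used (map bit s) = stk st ctl u s.
Proof. by apply/funext => -[k|[[]|]]. Qed.

Notation run := (runs (sstep ecode) (sev ecode)).

Lemma run_data b q q' st ctl u v w j x c' es :
  ecode q = IPush (inl j) (inl x) q' ->
  run false (q', stk (upd st j (x :: st j)) ctl u v, w) c' es -> run b (q, stk st ctl u v, w) c' es.
Proof.
move=> codeq rn; apply: runsS; rewrite /= codeq //=.
by rewrite -(upd_data _ _ _ _ j (x :: st j)) in rn.
Qed.

Lemma run_ctl b q q' st ctl u v w n c' es :
  ecode q = IPush Ctl (nodesym n) q' ->
  run false (q', stk st (n :: ctl) u v, w) c' es -> run b (q, stk st ctl u v, w) c' es.
Proof.
move=> codeq rn; apply: runsS; rewrite /= codeq //=.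
by rewrite -(upd_ctl st ctl u v (n :: ctl)) in rn.
Qed.

Lemma run_bits b q q' st ctl u v w c c' es :
  ecode q = IPush Bits (bit c) q' ->
  run false (q', stk st ctl (c :: u) v, w) c' es -> run b (q, stk st ctl u v, w) c' es.
Proof.
move=> codeq rn; apply: runsS; rewrite /= codeq //=.
by rewrite -(upd_bits st ctl u v (c :: u)) in rn.
Qed.

Lemma run_used b q q' st ctl u v w c c' es :
  ecode q = IPush Used (bit c) q' ->
  run false (q', stk st ctl u (c :: v), w) c' es -> run b (q, stk st ctl u v, w) c' es.
Proof.
move=> codeq rn; apply: runsS; rewrite /= codeq //=.
by rewrite -(upd_used st ctl u v (c :: v)) in rn.
Qed.

Lemma run_pop_data b q f st ctl u v w j c' es :
  ecode q = IPop (inl j) f ->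
  run false (f (omap inl (ohead (st j))), stk (upd st j (behead (st j))) ctl u v, w) c' es ->
  run b (q, stk st ctl u v, w) c' es.
Proof.
move=> codeq rn; apply: runsS; rewrite /= codeq //=.
by rewrite behead_map upd_data; case: (st j) rn.
Qed.

Lemma run_pop_ctl b q f st ctl u v w c' es :
  ecode q = IPop Ctl f ->
  run false (f (omap nodesym (ohead ctl)), stk st (behead ctl) u v, w) c' es ->
  run b (q, stk st ctl u v, w) c' es.
Proof.
move=> codeq rn; apply: runsS; rewrite /= codeq //=.
by rewrite behead_map upd_ctl; case: ctl rn.
Qed.

Lemma run_pop_bits b q f st ctl u v w c' es :
  ecode q = IPop Bits f ->
  run false (f (omap bit (ohead u)), stk st ctl (behead u) v, w) c' es ->
  run b (q, stk st ctl u v, w) c' es.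
Proof.
move=> codeq rn; apply: runsS; rewrite /= codeq //=.
by rewrite behead_map upd_bits; case: u rn.
Qed.

Lemma run_pop_used b q f st ctl u v w c' es :
  ecode q = IPop Used f ->
  run false (f (omap bit (ohead v)), stk st ctl u (behead v), w) c' es ->
  run b (q, stk st ctl u v, w) c' es.
Proof.
move=> codeq rn; apply: runsS; rewrite /= codeq //=.
by rewrite behead_map upd_used; case: v rn.
Qed.

Lemma run_out b q q' st ctl u v w o c' es :
  ecode q = IOut o q' -> (if o is EndWord then false else true) ->
  run false (q', stk st ctl u v, emit o w) c' es -> run b (q, stk st ctl u v, w) c' es.
Proof. by move=> codeq o_ok rn; apply: runsS; rewrite /= codeq //; case: o o_ok codeq rn. Qed.

Arguments run_ctl {b q} q' {st ctl u v w n c' es}.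
Arguments run_out {b q q' st ctl u v w} o {c' es}.
Arguments run_pop_data {b q f st ctl u v w j c' es}.

Lemma run_output st ctl u v w :
  exists st', run false (Output, stk st ctl u v, w) (Reset, stk st' ctl u v, [::])
    [:: w ++ pmap dec (st out)].
Proof.
move def_s: (st out) => s; elim: s st w def_s => [|x s IHs] st w def_s.
  exists (upd st out [::]); apply: run_pop_data => //; rewrite def_s /= cats0.
  rewrite -[X in runs _ _ _ _ _ X]cats0.
  have -> : [:: w] = sev ecode (OutputEnd, stk (upd st out [::]) ctl u v, w) by [].
  exact: runs_trans (runs1 _ _ false _) (runs0 _ _ _).
pose w' := w ++ pmap dec [:: x].
have [|st' IH] := IHs (upd st out s) w'; first by rewrite /upd eqxx.
exists st'; apply: run_pop_data => //; rewrite def_s /=.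
apply: (run_out (if dec x is Some a then Print a else Silent)) => //; first by case: (dec x).
move: IH; rewrite /w' -catA -pmap_cat /= /oapp.
by case: (dec x) => [a|] /=; rewrite ?cats1 ?cats0.
Qed.

(** A failed attempt leaves debris on the stacks, hence the existentials. What survives is that the
    bits read and unread together still spell the string being tried, so that it can be restored and
    incremented. *)
Lemma run_exec u st ctl v :
  exists st' ctl' u' v', rev v' ++ u' = rev v ++ u /\
    run false (Exec, stk st ctl u v, [::]) (Reset, stk st' ctl' u' v', [::])
      (if exec u (map val ctl) st is Some st' then [:: pmap dec (st' out)] else [::]).
Proof.
elim: u st ctl v => [|c u IHu] st ctl v.
  case: ctl => [|n ctl] /=.
    have [st' out_st] := run_output st [::] [::] v [::].
    exists st', [::], [::], v; split=> //.
    by apply: run_pop_bits => //=; apply: run_pop_ctl.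
  exists st, ctl, [::], v; split=> //.
  by apply: run_pop_bits => //=; apply: run_pop_ctl => //=; apply: runs0.
have start es :
    (exists st' ctl' u' v', rev v' ++ u' = rev (c :: v) ++ u /\
      run false (Control c, stk st ctl u (c :: v), [::]) (Reset, stk st' ctl' u' v', [::]) es) ->
    exists st' ctl' u' v', rev v' ++ u' = rev v ++ c :: u /\
      run false (Exec, stk st ctl (c :: u) v, [::]) (Reset, stk st' ctl' u' v', [::]) es.
  move=> [st' [ctl' [u' [v' [def_u rn]]]]]; exists st', ctl', u', v'; split.
    by rewrite def_u rev_cons cat_rcons.
  by apply: run_pop_bits => //=; apply: run_used.
case: ctl start => [|n ctl] start.
  apply: start; exists st, [::], u, (c :: v); split=> //.
  by apply: run_pop_ctl => //=; apply: runs0.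
have {}start q st1 ctl1 es :
    (exists st' ctl' u' v', rev v' ++ u' = rev (c :: v) ++ u /\
      run false (q, stk st1 ctl1 u (c :: v), [::]) (Reset, stk st' ctl' u' v', [::]) es) ->
    (forall c' es', run false (q, stk st1 ctl1 u (c :: v), [::]) c' es' ->
      run false (Do c n, stk st ctl u (c :: v), [::]) c' es') ->
    exists st' ctl' u' v', rev v' ++ u' = rev v ++ c :: u /\
      run false (Exec, stk st (n :: ctl) (c :: u) v, [::]) (Reset, stk st' ctl' u' v', [::]) es.
  move=> [st' [ctl' [u' [v' [def_u rn]]]]] do_n; apply: start.
  by exists st', ctl', u', v'; split=> //; apply: run_pop_ctl => //=; apply: do_n.
have fail st1 : exists st' ctl' u' v', rev v' ++ u' = rev (c :: v) ++ u /\
    run false (Reset, stk st1 ctl u (c :: v), [::]) (Reset, stk st' ctl' u' v', [::]) [::].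
  by exists st1, ctl, u, (c :: v); split=> //; apply: runs0.
case def_n: (val n) => [||j x|j x|j|e1 e2|e1 e2|e1] /=; rewrite def_n.
- by apply: (start _ _ _ _ (IHu st ctl (c :: v))) => c' es'; apply: (run_out Silent); rewrite //= def_n.
- by apply: (start _ _ _ _ (fail st)) => c' es'; apply: (run_out Silent); rewrite //= def_n.
- apply: (start _ _ _ _ (IHu (upd st j (x :: st j)) ctl (c :: v))) => c' es'.
  by apply: run_data; rewrite //= def_n.
- have codeq : ecode (Do c n) = IPop (inl j) (fun o => if o == Some (inl x) then Exec else Reset).
    by rewrite /= def_n.
  case: eqP => [stj | ne_x].
    apply: (start _ _ _ _ (IHu (upd st j (behead (st j))) ctl (c :: v))) => c' es' rn.
    by apply: (run_pop_data codeq); rewrite stj eqxx.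
  apply: (start _ _ _ _ (fail (upd st j (behead (st j))))) => c' es' rn.
  apply: (run_pop_data codeq); case: eqP => // stj; case: ne_x.
  by case: (st j) stj => //= y s [->].
- have codeq : ecode (Do c n) = IPop (inl j) (fun o => if o is None then Exec else Reset).
    by rewrite /= def_n.
  case stj: (st j) => [|y s].
    apply: (start _ _ _ _ (IHu st ctl (c :: v))) => c' es' rn.
    by apply: (run_pop_data codeq); rewrite stj /= -stj upd_id.
  apply: (start _ _ _ _ (fail (upd st j (behead (st j))))) => c' es' rn.
  by apply: (run_pop_data codeq); rewrite stj /= in rn *.
- have := IHu st [:: node_of n e1, node_of n e2 & ctl] (c :: v).
  rewrite /= !val_node_of ?def_n /= ?mem_seq2 ?eqxx ?orbT // => IH.
  apply: (start _ _ _ _ IH) => c' es' rn; apply: (run_ctl (PushNode (node_of n e1))).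
    by rewrite /= def_n.
  exact: run_ctl rn.
- have := IHu st (node_of n (if c then e1 else e2) :: ctl) (c :: v).
  rewrite /= val_node_of ?def_n /= ?mem_seq2; last by case: (c); rewrite eqxx ?orbT.
  move=> IH; apply: (start _ _ _ _ IH) => c' es' rn.
  by apply: run_ctl rn; rewrite /= def_n.
case: c start fail => start fail.
  have := IHu st [:: node_of n e1, n & ctl] (true :: v).
  rewrite /= val_node_of ?def_n /= ?mem_seq1 // => IH.
  apply: (start _ _ _ _ IH) => c' es' rn; apply: (run_ctl (PushNode (node_of n e1))).
    by rewrite /= def_n.
  exact: run_ctl rn.
apply: (start _ _ _ _ (IHu st ctl (false :: v))) => c' es' rn.
by apply: (run_out Silent _ _ rn); rewrite /= ?def_n.
Qed.

Lemma run_restore b r st ctl u v c' es :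
  run false (if r then Incr else Start, stk st ctl (rev v ++ u) [::], [::]) c' es ->
  run b (Restore r, stk st ctl u v, [::]) c' es.
Proof.
elim: v b u => [|c v IHv] b u rn; apply: run_pop_used => //=.
apply: run_bits => //=; apply: IHv.
by rewrite rev_cons cat_rcons in rn.
Qed.

Lemma run_incr b st ctl u v c' es :
  run false (Start, stk st ctl (rev v ++ incr u) [::], [::]) c' es ->
  run b (Incr, stk st ctl u v, [::]) c' es.
Proof.
elim: u b v => [|[] u IHu] b v /= rn; apply: run_pop_bits => //=.
- by apply: run_bits => //=; apply: run_restore.
- apply: run_used => //=; apply: IHu.
  by rewrite rev_cons cat_rcons.
- by apply: run_bits => //=; apply: run_restore.
Qed.

Definition outputs (u : seq bool) : seq (seq A) :=
  if exec u [:: e0] (fun=> [::]) is Some st then [:: pmap dec (st out)] else [::].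

Lemma run_round u :
  run true (Start, stk (fun=> [::]) [::] u [::], [::])
    (Start, stk (fun=> [::]) [::] (incr u) [::], [::]) (outputs u).
Proof.
have [st [ctl [u' [v' [/= def_u rn]]]]] := run_exec u (fun=> [::]) [:: root] [::].
apply: run_ctl => //=; apply: runs_silentr rn _.
apply: runsS => //=.
have -> : (fun k : estack => if match k with inr (Some _) => false | _ => true end
    then [::] else stk st ctl u' v' k) = stk (fun=> [::]) [::] u' v'.
  by apply/funext => -[k|[[]|]].
by apply: run_restore => //=; apply: run_incr; rewrite /= def_u; apply: runs0.
Qed.

(** Iterating [incr] from the empty string is itself a system, which emits [outputs u] at [u]. The
    stack machine simulates it round by round, and by [incr_onto] its emissions are the outcomes of
    all choice strings. *)
Theorem den_listable :
  listable (fun w => exists2 st, den e0 (fun=> [::]) st & w = pmap dec (st out)).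
Proof.
have [M listM] := stack_machine_listable ecode Start.
exists M => w; apply: iff_trans (listM w) _.
pose Sim (u : seq bool) (c : @sconf estack tagged_sym estate A) :=
  c = (Start, stk (fun=> [::]) [::] u [::], [::]).
rewrite -(simulation (f := incr) (ev := outputs) (Sim := Sim) (x := [::])).
- split=> [[n] | [st /denE[u exec_u] ->]].
    rewrite /outputs; case exec_u: (exec _ _ _) => [st|] //; rewrite mem_seq1 => /eqP->.
    by exists st => //; apply/denE; eexists; apply: exec_u.
  have [n def_u] := incr_onto u; exists n.
  by rewrite def_u /outputs exec_u mem_head.
- by move=> u _ ->; exists (Start, stk (fun=> [::]) [::] (incr u) [::], [::]) => //; apply: run_round.
- by congr (_, _, _); apply/funext => -[k|[[]|]].
Qed.

End Enumerate.

(** * Programs simulating a machine and rewriting words *)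

Section Rules.
Context {K B : finType}.
Implicit Types (st p r : K -> seq B) (e : prog K B).

Definition nop : K -> seq B := fun=> [::].

Definition stadd p st : K -> seq B := fun k => p k ++ st k.

Definition stdrop p st : K -> seq B := fun k => drop (size (p k)) (st k).

Definition push_seq j (l : seq B) : prog K B :=
  foldr (fun x e => Seq e (Push j x)) Skip l.

Definition pop_seq j (l : seq B) : prog K B :=
  foldr (fun x e => Seq (Pop j x) e) Skip l.

(** Prefix rewriting on all stacks at once, the elementary move of the programs below; [p := nop]
    gives an unconditional push. *)
Definition rule p r : prog K B :=
  Seq (foldr (fun j => Seq (pop_seq j (p j))) Skip (enum K))
      (foldr (fun j => Seq (push_seq j (r j))) Skip (enum K)).

Lemma den_push_seq j l st st' : den (push_seq j l) st st' <-> st' = upd st j (l ++ st j).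
Proof.
elim: l st st' => [|x l IHl] st st' /=; first by rewrite upd_id.
split=> [[st1 /IHl-> ->] | ->]; first by rewrite upd_upd upd_same.
by exists (upd st j (l ++ st j)); [apply/IHl | rewrite upd_upd upd_same].
Qed.

Lemma den_pop_seq j l st st' :
  den (pop_seq j l) st st' <-> take (size l) (st j) = l /\ st' = upd st j (drop (size l) (st j)).
Proof.
elim: l st st' => [|x l IHl] st st' /=.
  by rewrite take0 drop0 upd_id; split=> [->|[]].
split=> [[st1 [s stj ->] /IHl] | []].
  by rewrite upd_upd upd_same stj /= => -[-> ->].
case stj: (st j) => [|y s] //= [-> def_l] ->; exists (upd st j s); first by exists s.
by apply/IHl; rewrite upd_upd upd_same.
Qed.

Lemma den_rule p r st st' :
  den (rule p r) st st' <->
  (forall k, take (size (p k)) (st k) = p k) /\ st' = stadd r (stdrop p st).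
Proof.
have popsE ks : uniq ks -> forall st st',
    den (foldr (fun j => Seq (pop_seq j (p j))) Skip ks) st st' <->
    (forall k, k \in ks -> take (size (p k)) (st k) = p k)
    /\ st' = fun k => if k \in ks then stdrop p st k else st k.
  elim: ks => [|j ks IHks] /=; first by move=> _ {}st {}st'; split=> [->|[]].
  move=> /andP[j_ks /IHks{IHks}IHks] {}st {}st'.
  have stE : (fun k => if k \in ks then stdrop p (upd st j (drop (size (p j)) (st j))) k
        else upd st j (drop (size (p j)) (st j)) k)
      = fun k => if k \in j :: ks then stdrop p st k else st k.
    apply/funext => k; rewrite in_cons /stdrop /upd.
    by case: eqP => [->|] /=; rewrite ?(negPf j_ks).
  split=> [[st1 /den_pop_seq[pj ->] /IHks[pks ->]] | [pks ->]].
    split=> // k; rewrite in_cons => /predU1P[-> // | k_ks].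
    have := pks k k_ks; rewrite /upd; case: eqP => // def_k.
    by rewrite -def_k k_ks in j_ks.
  exists (upd st j (drop (size (p j)) (st j))).
    by apply/den_pop_seq; split=> //; apply: pks; rewrite mem_head.
  apply/IHks; split=> // k k_ks; rewrite /upd; case: eqP => [def_k|_].
    by rewrite -def_k k_ks in j_ks.
  by apply: pks; rewrite in_cons k_ks orbT.
have pushesE ks : uniq ks -> forall st st',
    den (foldr (fun j => Seq (push_seq j (r j))) Skip ks) st st' <->
    st' = fun k => if k \in ks then stadd r st k else st k.
  elim: ks => [|j ks IHks] //= /andP[j_ks /IHks{IHks}IHks] {}st {}st'.
  have stE : (fun k => if k \in ks then stadd r (upd st j (r j ++ st j)) k
        else upd st j (r j ++ st j) k)
      = fun k => if k \in j :: ks then stadd r st k else st k.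
    apply/funext => k; rewrite in_cons /stadd /upd.
    by case: eqP => [->|] /=; rewrite ?(negPf j_ks).
  split=> [[st1 /den_push_seq-> /IHks->] | ->] //.
  by exists (upd st j (r j ++ st j)); [apply/den_push_seq | apply/IHks].
have inK k : k \in enum K by rewrite mem_enum.
have {popsE}popsE := popsE _ (enum_uniq K); have {pushesE}pushesE := pushesE _ (enum_uniq K).
have allE (f : K -> seq B) st0 : (fun k => if k \in enum K then f k else st0 k) = f.
  by apply/funext => k; rewrite inK.
split=> [[st1 /popsE[pK ->] /pushesE->] | [pK ->]].
  by rewrite !allE; split=> // k; apply: pK.
exists (stdrop p st); first by apply/popsE; rewrite allE; split.
by apply/pushesE; rewrite allE.
Qed.

Definition any (T : finType) (f : T -> prog K B) : prog K B :=
  foldr (fun x => Alt (f x)) Fail (enum T).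

Lemma den_any (T : finType) (f : T -> prog K B) st st' :
  den (any f) st st' <-> exists x, den (f x) st st'.
Proof.
suff IH s : den (foldr (fun x => Alt (f x)) Fail s) st st' <->
    exists2 x, x \in s & den (f x) st st'.
  by rewrite IH; split=> [[x _ fx]|[x fx]]; exists x; rewrite ?mem_enum.
elim: s => /= [|x s ->]; first by split=> // -[].
split=> [[fx|[y ys fy]]|[y]]; [exists x | exists y | rewrite in_cons => /predU1P[->|ys fy]].
- by rewrite mem_head.
- by [].
- by rewrite in_cons ys orbT.
- by [].
- by left.
- by right; exists y.
Qed.

Definition computes e (F : (K -> seq B) -> K -> seq B) :=
  forall st st', den e st st' <-> st' = F st.

Lemma computes_seq e1 e2 F1 F2 :
  computes e1 F1 -> computes e2 F2 -> computes (Seq e1 e2) (F2 \o F1).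
Proof.
move=> e1F e2F st st'; split=> [[st1 /e1F-> /e2F] // | ->].
by exists (F1 st); [apply/e1F | apply/e2F].
Qed.

Lemma computes_push r : computes (rule nop r) (stadd r).
Proof.
move=> st st'; rewrite den_rule.
have -> : stdrop nop st = st by apply/funext => k; rewrite /stdrop drop0.
by split=> [[]|->] //; split=> // k; rewrite take0.
Qed.

Definition only (j : K) (s : seq B) : K -> seq B := fun k => if k == j then s else [::].

Lemma stadd_only j s st : stadd (only j s) st = upd st j (s ++ st j).
Proof. by apply/funext => k; rewrite /stadd /only /upd; case: eqP => [->|]. Qed.

Lemma stdrop_only j s st : stdrop (only j s) st = upd st j (drop (size s) (st j)).
Proof.
apply/funext => k; rewrite /stdrop /only /upd; case: eqP => [->|] //=.
by rewrite drop0.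
Qed.

Lemma den_pop_only j s r st st' :
  den (rule (only j s) r) st st' <-> exists2 t, st j = s ++ t & st' = stadd r (upd st j t).
Proof.
rewrite den_rule stdrop_only; split=> [[/(_ j) pj ->] | [t stj ->]].
  exists (drop (size s) (st j)) => //.
  by rewrite -[LHS](cat_take_drop (size s)); move: pj; rewrite /only eqxx => ->.
rewrite stj drop_size_cat //; split=> // k; rewrite /only; case: eqP => [->|_] /=.
  by rewrite stj take_size_cat.
by rewrite take0.
Qed.

Definition drain j (g : B -> K -> seq B) : prog K B :=
  Seq (Star (any (fun x => rule (only j [:: x]) (g x)))) (Emp j).

(** [rev] because what is popped last ends up on top. *)
Definition outpour (T : Type) (g : T -> K -> seq B) (s : seq T) : K -> seq B :=
  fun k => flatten (rev [seq g x k | x <- s]).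

Lemma outpour_cons (T : Type) (g : T -> K -> seq B) x s st :
  stadd (outpour g (x :: s)) st = stadd (outpour g s) (stadd (g x) st).
Proof.
apply/funext => k; rewrite /stadd /outpour /= rev_cons -cats1 flatten_cat /= cats0.
by rewrite catA.
Qed.

Lemma outpour_only (T : Type) j (h : T -> seq B) (s : seq T) :
  outpour (fun x => only j (h x)) s = only j (flatten (rev (map h s))).
Proof.
apply/funext => k; rewrite /outpour /only; case: eqP => // _.
by elim: s => //= x s IHs; rewrite rev_cons -cats1 flatten_cat IHs.
Qed.

Lemma outpour_nop (T : Type) (s : seq T) : outpour (fun=> nop) s = nop.
Proof.
apply/funext => k; rewrite /outpour; elim: s => //= x s IHs.
by rewrite rev_cons -cats1 flatten_cat IHs.
Qed.

(** The loop is nondeterministic, but the final [Emp j] rejects every run that stops early, so the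
    program is a function. The hypothesis keeps the source from being refilled. *)
Lemma computes_drain j g : (forall x, g x j = [::]) ->
  computes (drain j g) (fun st => stadd (outpour g (st j)) (upd st j [::])).
Proof.
move=> gj.
have updg x s l : upd (stadd (g x) (upd s j l)) j [::] = stadd (g x) (upd s j [::]).
  by apply/funext => k; rewrite /stadd /upd; case: eqP => // ->; rewrite gj.
have atj x s l : stadd (g x) (upd s j l) j = l by rewrite /stadd gj upd_same.
move=> st st'; split.
  case=> st1 st_st1 [st1j ->]; elim: st_st1 st1j => {st st1} [s sj|s s2 s1 /den_any[x /den_pop_only[l sj ->]] _ IH s1j].
    by have -> : upd s j [::] = s by [rewrite -sj upd_id]; rewrite sj.
  by rewrite IH // updg atj sj outpour_cons.
move=> ->; exists (stadd (outpour g (st j)) (upd st j [::])); last first.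
  split=> //; rewrite /stadd upd_same cats0 /outpour.
  by elim: (st j) => //= x l IHl; rewrite rev_cons -cats1 flatten_cat IHl /= gj.
move def_l: (st j) => l; elim: l st def_l => [|x l IHl] st def_l.
  by have -> : upd st j [::] = st by [rewrite -def_l upd_id]; apply: star0.
apply: (@starS _ _ _ (stadd (g x) (upd st j l))).
  by apply/den_any; exists x; apply/den_pop_only; exists l.
by rewrite outpour_cons -(updg x st l); apply: IHl.
Qed.

(** The guessing primitive: one arbitrary list over [T] is chosen, and its traces on the different
    stacks agree. *)
Definition scatter (T : finType) (g : T -> K -> seq B) : prog K B :=
  Star (any (fun x => rule nop (g x))).

Lemma den_scatter (T : finType) (g : T -> K -> seq B) st st' :
  den (scatter g) st st' <-> exists s : seq T, st' = stadd (outpour g s) st.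
Proof.
split=> [|[s ->]].
  elim=> [{}st|{}st st1 {}st' /den_any[x /computes_push->] _ [s ->]]; first by exists [::].
  by exists (x :: s); rewrite outpour_cons.
elim: s st => [|x s IHs] st; first exact: star0.
rewrite outpour_cons; apply: starS (IHs _).
by apply/den_any; exists x; apply/computes_push.
Qed.

End Rules.

Opaque rule any drain scatter.

Lemma winv_cat n (u v : seq (letter n)) : winv (u ++ v) = winv v ++ winv u.
Proof. by rewrite /winv map_cat rev_cat. Qed.

Lemma linvK n : involutive (@linv n).
Proof. by case=> i b; rewrite /linv /= negbK. Qed.

Lemma winvK n : involutive (@winv n).
Proof. by move=> w; rewrite /winv map_rev revK mapK //; apply: linvK. Qed.

Lemma winv_flatten n (us : seq (seq (letter n))) :
  winv (flatten us) = flatten (rev (map winv us)).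
Proof.
elim: us => //= u us IHus.
by rewrite winv_cat IHus rev_cons -cats1 flatten_cat /= cats0.
Qed.

(* kS, kL, kH, kR, kW hold the state, the tape to the left of the head, the
   scanned symbol, the tape to the right, and the printed word of a simulated
   machine; kX and kY hold a word cut at a cursor. *)
Inductive key := kS | kL | kH | kR | kW | kZ1 | kZ2 | kZ3 | kZ4 | kT | kX | kY | kO.

Definition keys := [:: kS; kL; kH; kR; kW; kZ1; kZ2; kZ3; kZ4; kT; kX; kY; kO].

Definition key_code (k : key) : nat :=
  match k with
  | kS => 0 | kL => 1 | kH => 2 | kR => 3 | kW => 4 | kZ1 => 5 | kZ2 => 6
  | kZ3 => 7 | kZ4 => 8 | kT => 9 | kX => 10 | kY => 11 | kO => 12
  end.

Lemma key_codeK : cancel key_code (nth kS keys).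
Proof. by case. Qed.

HB.instance Definition _ := Countable.copy key (can_type key_codeK).

Lemma keys_enum : Finite.axiom keys.
Proof. by case. Qed.

HB.instance Definition _ := isFinite.Build key keys_enum.

(** * Running a Turing machine inside a program *)

Section Simulator.
Context {A C : finType} (M : machine A).

Definition sym : finType := ((state M + symbol M) + (A + C))%type.
Definition iQ (q : state M) : sym := inl (inl q).
Definition iT (a : symbol M) : sym := inl (inr a).
Definition iA (x : A) : sym := inr (inl x).
Definition iC (c : C) : sym := inr (inr c).

Implicit Types (rest : key -> seq sym).

Definition cst (q : seq (state M)) (l h r : seq (symbol M)) (w : seq A) rest : key -> seq sym :=
  fun k => match k with
  | kS => map iQ q
  | kL => map iT l
  | kH => map iT h
  | kR => map iT r
  | kW => map iA w
  | _ => rest k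
  end.

Definition fetch (k : key) : prog key sym :=
  Alt (any (fun b => rule (only k [:: iT b]) (only kH [:: iT b])))
      (Seq (Emp k) (rule nop (only kH [:: iT (blank M)]))).

Definition mmove (d : direction) (a : symbol M) : prog key sym :=
  match d with
  | GoLeft => Seq (rule nop (only kR [:: iT a])) (fetch kL)
  | Stay => rule nop (only kH [:: iT a])
  | GoRight => Seq (rule nop (only kL [:: iT a])) (fetch kR)
  end.

Definition mout (o : output A) : prog key sym :=
  match o with
  | Silent => Skip
  | Print x => rule nop (only kW [:: iA x])
  | EndWord => drain kW (fun=> nop)
  end.

Definition scan (q : state M) (a : symbol M) : key -> seq sym :=
  fun k => match k with kS => [:: iQ q] | kH => [:: iT a] | _ => [::] end.

Definition mstep : prog key sym :=
  any (fun qa : state M * symbol M =>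
    if delta qa.1 qa.2 is Some (q', a', d, o) then
      Seq (rule (scan qa.1 qa.2) (only kS [:: iQ q'])) (Seq (mmove d a') (mout o))
    else Fail).

(** The step that ends a word is not carried out, since it would erase the word; removing the state
    and the scanned symbol leaves the word on [kW]. *)
Definition mfinish : prog key sym :=
  any (fun qa : state M * symbol M =>
    if delta qa.1 qa.2 is Some (q', a', d, EndWord) then rule (scan qa.1 qa.2) nop
    else Fail).

Definition mrun : prog key sym :=
  Seq (rule nop (scan (start M) (blank M)))
    (Seq (Star mstep) (Seq mfinish (Seq (drain kL (fun=> nop)) (drain kR (fun=> nop))))).

Lemma den_fetch k (t : seq (symbol M)) st st' :
  st k = map iT t -> k != kH -> st kH = [::] ->
  den (fetch k) st st' <->
  st' = upd (upd st k (map iT (behead t))) kH [:: iT (head (blank M) t)].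
Proof.
move=> stk ne_kH stH; have kHk : kH == k = false by apply/eqP => def_k; rewrite -def_k eqxx in ne_kH.
have atH s : upd st k s kH = [::] by rewrite /upd kHk.
have updH s s' : stadd (only kH s') (upd st k s) = upd (upd st k s) kH s'.
  by rewrite stadd_only atH cats0.
split=> [[/den_any[b /den_pop_only[s]] | [st1 [+ ->] /computes_push->]] | ->].
- by rewrite stk updH; case: t {stk} => //= c t [-> ->] ->.
- rewrite stk; case: t stk => //= stk _; rewrite -updH.
  by have -> : upd st k [::] = st by rewrite -[RHS](upd_id _ k) stk.
case: t stk => [|b t] stk /=.
  right; exists st; first by [].
  by apply/computes_push; rewrite -updH; have -> : upd st k [::] = st by rewrite -[RHS](upd_id _ k) stk.
by left; apply/den_any; exists b; apply/den_pop_only; exists (map iT t); rewrite ?updH.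
Qed.

Opaque fetch.

Lemma den_mmove d a q l r w rest st' :
  den (mmove d a) (cst q l [::] r w rest) st' <->
  st' = let: (l', h, r') := move_head d l a r in cst q l' [:: h] r' w rest.
Proof.
case: d => /=; last split=> [[st1 /computes_push->]|->].
- split=> [[st1 /computes_push->]|->].
    move/(den_fetch (k := kL) (t := l)) => -> //.
    by apply/funext; case.
  exists (stadd (only kR [:: iT a]) (cst q l [::] r w rest)); first exact/computes_push.
  by apply/(den_fetch (k := kL) (t := l)) => //; apply/funext; case.
- by rewrite (computes_push _ _ _); split=> ->; apply/funext; case.
- by move/(den_fetch (k := kR) (t := r)) => -> //; apply/funext; case.
exists (stadd (only kL [:: iT a]) (cst q l [::] r w rest)); first exact/computes_push.
by apply/(den_fetch (k := kR) (t := r)) => //; apply/funext; case.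
Qed.

Lemma den_mout o q l h r w rest st' :
  den (mout o) (cst q l h r (rev w) rest) st' <-> st' = cst q l h r (rev (emit o w)) rest.
Proof.
case: o => [|x|]; first by [].
  by rewrite (computes_push _ _ _) /= rev_rcons; split=> ->; apply/funext; case.
by rewrite (computes_drain _) // outpour_nop; split=> ->; apply/funext; case.
Qed.

Opaque mmove mout.

Definition conf_st (c : config M) rest : key -> seq sym :=
  cst [:: cstate c] (cleft c) [:: chead c] (cright c) (rev (cword c)) rest.

Lemma den_scan q a r c rest st' :
  den (rule (scan q a) r) (conf_st c rest) st' <->
  [/\ q = cstate c, a = chead c & st' = stadd r (cst [::] (cleft c) [::] (cright c) (rev (cword c)) rest)].
Proof.
have dropE : stdrop (scan (cstate c) (chead c)) (conf_st c rest) =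
    cst [::] (cleft c) [::] (cright c) (rev (cword c)) rest.
  by apply/funext; case; rewrite /stdrop /= ?drop0.
rewrite den_rule; split=> [[pk ->] | [-> -> ->]].
  by have [[<-] [<-]] := (pk kS, pk kH); rewrite dropE.
by rewrite dropE; split=> //; case; rewrite /= ?take0.
Qed.

Lemma den_mstep c rest st' :
  den mstep (conf_st c rest) st' <-> exists2 c', step c = Some c' & st' = conf_st c' rest.
Proof.
have addE q : stadd (only kS [:: iQ q]) (cst [::] (cleft c) [::] (cright c) (rev (cword c)) rest)
    = cst [:: q] (cleft c) [::] (cright c) (rev (cword c)) rest by apply/funext; case.
rewrite /step; split=> [/den_any[[q a] /=] | [c']].
  case dl: (delta q a) => [[[[q' a'] d] o]|] // [st1 /den_scan[def_q def_a ->] [st2]].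
  rewrite addE => /den_mmove; rewrite -def_q -def_a dl.
  case: (move_head _ _ _ _) => [[l h] r] -> /den_mout->.
  by eexists.
case dl: (delta _ _) => [[[[q' a'] d] o]|] //.
case mv: (move_head _ _ _ _) => [[l h] r] [<-] -> /=.
apply/den_any; exists (cstate c, chead c); rewrite /= dl.
exists (cst [:: q'] (cleft c) [::] (cright c) (rev (cword c)) rest).
  by apply/den_scan; rewrite addE.
exists (cst [:: q'] l [:: h] r (rev (cword c)) rest); last exact/den_mout.
by apply/den_mmove; rewrite mv.
Qed.

Opaque mstep.

(** [Star mstep] guesses how many steps precede the listing of the word. The word comes out reversed
    because printing pushes on top of [kW]. The stacks of [rest] are untouched, so the run can serve
    as a subroutine. *)
Lemma den_mrun rest st' :
  den mrun (cst [::] [::] [::] [::] [::] rest) st' <->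
  exists2 w, lists M w & st' = cst [::] [::] [::] [::] (rev w) rest.
Proof.
have startE : stadd (scan (start M) (blank M)) (cst [::] [::] [::] [::] [::] rest)
    = conf_st (init_config M) rest by apply/funext; case.
have stepsE c st1 : star (den mstep) (conf_st c rest) st1 <->
    exists n c', iter n (obind (@step _ M)) (Some c) = Some c' /\ st1 = conf_st c' rest.
  split=> [star_c | [n [c' [+ ->]]]].
    move def_st: (conf_st c rest) star_c => st0 star_c.
    elim: star_c c def_st => [st c <-|st st2 st3 + _ IH c def_st]; first by exists 0, c.
    rewrite -def_st => /den_mstep[c2 step_c def_st2].
    have [n [c' [iter_c def_st3]]] := IH c2 (esym def_st2).
    by exists n.+1, c'; rewrite iterSr /= step_c.
  elim: n c => [|n IHn] c; first by move=> [->]; apply: star0.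
  rewrite iterSr /=; case step_c: (step c) => [c1|] iter_c.
    by apply: starS (IHn _ iter_c); apply/den_mstep; exists c1.
  have iterN k : iter k (obind (@step _ M)) None = None by elim: k => //= k ->.
  by rewrite iterN in iter_c.
have clearE : @computes key sym (Seq (drain kL (fun=> nop)) (drain kR (fun=> nop)))
    (fun st => upd (upd st kL [::]) kR [::]).
  move=> st1 st2.
  have -> := computes_seq (computes_drain (g := fun=> nop) (j := kL) _)
    (computes_drain (g := fun=> nop) (j := kR) _) st1 st2; try by [].
  by rewrite /= !outpour_nop.
have endE c : upd (upd (stadd nop (cst [::] (cleft c) [::] (cright c) (rev (cword c)) rest)) kL [::])
    kR [::] = cst [::] [::] [::] [::] (rev (cword c)) rest by apply/funext; case.
split=> [[st1 /computes_push-> [st2]] | [w [n [c [q [a [d [run_c dl <-]]]]]] ->]].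
  rewrite startE => /stepsE[n [c [run_c ->]]] [st3 /den_any[[q a]] /=].
  case dl: (delta q a) => [[[[q' a'] d] []]|] // /den_scan[def_q def_a ->] /clearE.
  rewrite endE => ->; exists (cword c) => //.
  by exists n, c, q', a', d; split; rewrite // -def_q -def_a.
exists (conf_st (init_config M) rest); first by apply/computes_push.
exists (conf_st c rest); first by apply/stepsE; exists n, c.
exists (stadd nop (cst [::] (cleft c) [::] (cright c) (rev (cword c)) rest)).
  by apply/den_any; exists (cstate c, chead c); rewrite /= dl; apply/den_scan.
by apply/clearE; rewrite endE.
Qed.

Opaque mrun.

Section CommutatorWords.
Context {n : nat} (g : sym -> seq (letter n)) (put : letter n -> sym) (c d : seq (letter n)).

Definition writeY (w : seq (letter n)) : prog key sym := rule nop (only kY (map put w)).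

Definition write_block (k : key) : prog key sym :=
  drain k (fun x => only kY (map put (g x))).

(** One drain yields the blocks in the order used by [block]; the detour through [kT] reverses them
    once more, as the inverse requires. *)
Definition write_inverse (k : key) : prog key sym :=
  Seq (drain k (fun x => only kT [:: x])) (drain kT (fun x => only kY (map put (winv (g x))))).

(** The commutator of z c z^-1 with d spells z c^-1 z^-1 d^-1 z c z^-1 d and is pushed on [kY] from
    right to left. Draining consumes its source, so the four occurrences of z need the four copies
    [kZ1] to [kZ4]. *)
Definition write_comm : prog key sym :=
  Seq (writeY d) (Seq (write_inverse kZ1) (Seq (writeY c) (Seq (write_block kZ2)
    (Seq (writeY (winv d)) (Seq (write_inverse kZ3) (Seq (writeY (winv c)) (write_block kZ4))))))).

Definition comm_st (z1 z2 z3 z4 : seq sym) (y : seq (letter n)) rest : key -> seq sym :=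
  fun k => match k with
  | kZ1 => z1 | kZ2 => z2 | kZ3 => z3 | kZ4 => z4 | kT => [::]
  | kY => map put y
  | _ => rest k
  end.

Definition block (zs : seq sym) := flatten (rev (map g zs)).

Lemma computes_write_block k : k != kY -> computes (write_block k)
  (fun st => stadd (only kY (map put (block (st k)))) (upd st k [::])).
Proof.
move=> kY' st st'; rewrite (computes_drain _) => [|x]; last by rewrite /only (negPf kY').
by rewrite outpour_only /block map_flatten map_rev -map_comp.
Qed.

Lemma den_write_inverse k st st' : st kT = [::] -> k != kT -> k != kY ->
  den (write_inverse k) st st' <->
  st' = stadd (only kY (map put (winv (block (st k))))) (upd st k [::]).
Proof.
move=> stT kT' kY'.
have gk x : only kT [:: x] k = [::] :> seq sym by rewrite /only (negPf kT').
have gT x : only kY (map put (winv (g x))) kT = [::] by [].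
rewrite (computes_seq (computes_drain gk) (computes_drain gT) st st') /=.
rewrite !outpour_only; set s1 := stadd _ (upd st k [::]).
have s1T : s1 kT = rev (st k).
  rewrite /s1 /stadd /upd eq_sym (negPf kT') stT cats0 /only eqxx.
  rewrite -map_rev; elim: (rev _) => //= x s -> //.
have -> : upd s1 kT [::] = upd st k [::].
  apply/funext => j; rewrite /s1 /upd /stadd /only; case: eqP => // ->.
  by rewrite eq_sym (negPf kT').
by rewrite s1T /block winv_flatten !map_rev !revK map_flatten -!map_comp.
Qed.

Lemma den_write_comm zs y rest st' :
  den write_comm (comm_st zs zs zs zs y rest) st' <->
  st' = comm_st [::] [::] [::] [::]
    (wcomm (block zs ++ c ++ winv (block zs)) d ++ y) rest.
Proof.
have wE w z1 z2 z3 z4 y1 st1 :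
    den (writeY w) (comm_st z1 z2 z3 z4 y1 rest) st1 <-> st1 = comm_st z1 z2 z3 z4 (w ++ y1) rest.
  rewrite (computes_push _ _ _); suff -> : stadd (only kY (map put w)) (comm_st z1 z2 z3 z4 y1 rest)
    = comm_st z1 z2 z3 z4 (w ++ y1) rest by [].
  by apply/funext; case; rewrite /stadd /= ?map_cat.
have i1 z1 z2 z3 z4 y1 st1 : den (write_inverse kZ1) (comm_st z1 z2 z3 z4 y1 rest) st1 <->
    st1 = comm_st [::] z2 z3 z4 (winv (block z1) ++ y1) rest.
  rewrite den_write_inverse //; suff -> : forall w, stadd (only kY (map put w))
    (upd (comm_st z1 z2 z3 z4 y1 rest) kZ1 [::]) = comm_st [::] z2 z3 z4 (w ++ y1) rest by [].
  by move=> w; apply/funext; case; rewrite /stadd /= ?map_cat.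
have i3 z1 z2 z3 z4 y1 st1 : den (write_inverse kZ3) (comm_st z1 z2 z3 z4 y1 rest) st1 <->
    st1 = comm_st z1 z2 [::] z4 (winv (block z3) ++ y1) rest.
  rewrite den_write_inverse //; suff -> : forall w, stadd (only kY (map put w))
    (upd (comm_st z1 z2 z3 z4 y1 rest) kZ3 [::]) = comm_st z1 z2 [::] z4 (w ++ y1) rest by [].
  by move=> w; apply/funext; case; rewrite /stadd /= ?map_cat.
have b2 z1 z2 z3 z4 y1 st1 : den (write_block kZ2) (comm_st z1 z2 z3 z4 y1 rest) st1 <->
    st1 = comm_st z1 [::] z3 z4 (block z2 ++ y1) rest.
  rewrite (computes_write_block _ _ _) //; suff -> : forall w, stadd (only kY (map put w))
    (upd (comm_st z1 z2 z3 z4 y1 rest) kZ2 [::]) = comm_st z1 [::] z3 z4 (w ++ y1) rest by [].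
  by move=> w; apply/funext; case; rewrite /stadd /= ?map_cat.
have b4 z1 z2 z3 z4 y1 st1 : den (write_block kZ4) (comm_st z1 z2 z3 z4 y1 rest) st1 <->
    st1 = comm_st z1 z2 z3 [::] (block z4 ++ y1) rest.
  rewrite (computes_write_block _ _ _) //; suff -> : forall w, stadd (only kY (map put w))
    (upd (comm_st z1 z2 z3 z4 y1 rest) kZ4 [::]) = comm_st z1 z2 z3 [::] (w ++ y1) rest by [].
  by move=> w; apply/funext; case; rewrite /stadd /= ?map_cat.
rewrite /wcomm !winv_cat !winvK -!catA.
split=> [[s1 /wE->] [s2 /i1->] [s3 /wE->] [s4 /b2->] [s5 /wE->] [s6 /i3->] [s7 /wE->] /b4 //|->].
by do ![eexists; first by apply/wE || apply/i1 || apply/b2 || apply/i3]; apply/b4.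
Qed.

End CommutatorWords.

Opaque write_comm.

End Simulator.

Arguments sym {A} C M.

(** The pair stands for the word [rev x ++ y] with a cursor in between. An inverse relator is
    inserted to the left, where the stack is read backwards, so inverting letter by letter already
    spells [winv w]. *)
Inductive zip_step n (R : seq (letter n) -> Prop) :
    seq (letter n) * seq (letter n) -> seq (letter n) * seq (letter n) -> Prop :=
| zip_back a x y : zip_step R (a :: x, y) (x, a :: y)
| zip_forth a x y : zip_step R (x, a :: y) (a :: x, y)
| zip_insert a x y : zip_step R (x, y) (x, [:: a, linv a & y])
| zip_cancel a x y : zip_step R (x, [:: a, linv a & y]) (x, y)
| zip_relator w x y : R w -> zip_step R (x, y) (x, w ++ y)
| zip_relatorV w x y : R w -> zip_step R (x, y) (map (@linv n) w ++ x, y).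

(** * Searching for trivial commutators in a presented group *)

Section Reduction.
Context {n : nat} (M : machine (letter n)) (c z d : seq (letter n)).
Local Notation B := (sym unit M).
Local Notation put := (@iA _ unit M).
Definition tick : B := iC M tt.

Definition zip_st (p : seq (letter n) * seq (letter n)) (o : seq unit) : key -> seq B :=
  fun k => match k with
  | kX => map put p.1
  | kY => map put p.2
  | kO => map (iC M) o
  | _ => [::]
  end.

Definition inv_sym (b : B) : B := if b is inr (inl a) then put (linv a) else b.

Definition zip_prog : prog key B :=
  Alt (any (fun a => rule (only kX [:: put a]) (only kY [:: put a])))
 (Alt (any (fun a => rule (only kY [:: put a]) (only kX [:: put a])))
 (Alt (any (fun a => rule nop (only kY [:: put a; put (linv a)])))
 (Alt (any (fun a => rule (only kY [:: put a; put (linv a)]) nop))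
 (Alt (Seq (mrun M) (drain kW (fun b => only kY [:: b])))
      (Seq (mrun M) (drain kW (fun b => only kX [:: inv_sym b]))))))).

Lemma den_zip_prog p o st' :
  den zip_prog (zip_st p o) st' <-> exists2 q, zip_step (lists M) p q & st' = zip_st q o.
Proof.
have cstE : zip_st p o = cst [::] [::] [::] [::] [::] (zip_st p o) by apply/funext; case.
have runE st1 : den (mrun M) (zip_st p o) st1 <->
    exists2 w, lists M w & st1 = cst [::] [::] [::] [::] (rev w) (zip_st p o).
  by rewrite {1}cstE; apply: den_mrun.
have relE w : stadd (outpour (fun b => only kY [:: b]) (map put (rev w)))
    (upd (cst [::] [::] [::] [::] (rev w) (zip_st p o)) kW [::]) = zip_st (p.1, w ++ p.2) o.
  rewrite outpour_only -2!map_rev revK -map_comp (flatten_map1 put).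
  by apply/funext; case; rewrite /stadd //= map_cat.
have relVE w : stadd (outpour (fun b => only kX [:: inv_sym b]) (map put (rev w)))
    (upd (cst [::] [::] [::] [::] (rev w) (zip_st p o)) kW [::])
    = zip_st (map (@linv n) w ++ p.1, p.2) o.
  rewrite outpour_only -2!map_rev revK -map_comp (flatten_map1 (put \o @linv n)) map_comp.
  by apply/funext; case; rewrite /stadd //= map_cat.
have drainY := computes_drain (g := fun b : B => only kY [:: b]) (j := kW) (fun=> erefl).
have drainX := computes_drain (g := fun b : B => only kX [:: inv_sym b]) (j := kW) (fun=> erefl).
split.
  case: p cstE runE relE relVE => x y cstE runE relE relVE.
  case=> [/den_any[a /den_pop_only[t]] |[/den_any[a /den_pop_only[t]] |[/den_any[a /computes_push->] |
    [/den_any[a /den_pop_only[t]] |[[st1 /runE[w Rw ->] /drainY->]|[st1 /runE[w Rw ->] /drainX->]]]]]].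
  - case: x {cstE runE relE relVE} => //= b x [<- <-] ->; exists (x, b :: y).
      exact: zip_back.
    by apply/funext; case.
  - case: y {cstE runE relE relVE} => //= b y [<- <-] ->; exists (b :: x, y).
      exact: zip_forth.
    by apply/funext; case.
  - exists (x, [:: a, linv a & y]); first exact: zip_insert.
    by apply/funext; case.
  - case: y {cstE runE relE relVE} => [|b [|b' y]] //= [-> -> <-] ->.
    exists (x, y); first exact: zip_cancel.
    by apply/funext; case.
  - by exists (x, w ++ y); [apply: zip_relator | rewrite relE].
  - by exists (map (@linv n) w ++ x, y); [apply: zip_relatorV | rewrite relVE].
case=> q pq ->; case: pq cstE runE relE relVE => [a x y|a x y|a x y|a x y|w x y Rw|w x y Rw] cstE runE relE relVE.
- left; apply/den_any; exists a; apply/den_pop_only; exists (map put x) => //.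
  by apply/funext; case.
- right; left; apply/den_any; exists a; apply/den_pop_only; exists (map put y) => //.
  by apply/funext; case.
- right; right; left; apply/den_any; exists a; apply/computes_push.
  by apply/funext; case.
- right; right; right; left; apply/den_any; exists a; apply/den_pop_only; exists (map put y) => //.
  by apply/funext; case.
- right; right; right; right; left.
  exists (cst [::] [::] [::] [::] (rev w) (zip_st (x, y) o)); first by apply/runE; exists w.
  by apply/drainY; rewrite relE.
- right; right; right; right; right.
  exists (cst [::] [::] [::] [::] (rev w) (zip_st (x, y) o)); first by apply/runE; exists w.
  by apply/drainX; rewrite relVE.
Qed.

Opaque zip_prog.

(** The same number of ticks is guessed on the four copies and on [kO]. A tick on a copy stands for
    one factor [z]; those on [kO] become the unary output if the word reduces to the empty one. *)
Definition reduction_prog : prog key B :=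
  Seq (scatter (fun (_ : unit) k =>
         match k with kZ1 | kZ2 | kZ3 | kZ4 | kO => [:: tick] | _ => [::] end))
 (Seq (write_comm (fun=> z) put c d)
 (Seq (Star zip_prog) (Seq (Emp kX) (Emp kY)))).

Definition power_word (i : nat) : seq (letter n) := flatten (nseq i z).

Theorem reduction_listable :
  listable (fun w : seq unit => exists2 i,
    star (zip_step (lists M)) ([::], wcomm (power_word i ++ c ++ winv (power_word i)) d) ([::], [::])
    & w = nseq i tt).
Proof.
have [N listN] := den_listable reduction_prog kO (fun b => if b is inr (inr _) then Some tt else None).
exists N => w; apply: iff_trans (listN w) _.
have starE p o st : star (den zip_prog) (zip_st p o) st <->
    exists2 q, star (zip_step (lists M)) p q & st = zip_st q o.
  split=> [s | [q s ->]].
    move def_st: (zip_st p o) s => st0 s.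
    elim: s p def_st => [s p <-|s s1 s2 + _ IH p def_s]; first by exists p => //; apply: star0.
    rewrite -def_s => /den_zip_prog[q pq /esym/IH[q1 qq1 ->]].
    by exists q1 => //; apply: starS pq qq1.
  elim: s => [{}p|p1 p2 p3 p12 _ IH]; first exact: star0.
  by apply: starS IH; apply/den_zip_prog; exists p2.
pose g (_ : unit) k : seq B := 
  match k with kZ1 | kZ2 | kZ3 | kZ4 | kO => [:: tick] | _ => [::] end.
have scatE s : stadd (outpour g s) (fun=> [::]) = comm_st put (nseq (size s) tick) (nseq (size s) tick)
    (nseq (size s) tick) (nseq (size s) tick) [::] (zip_st ([::], [::]) s).
  have flatE k : outpour g s k = flatten (nseq (size s) (g tt k)).
    by rewrite /outpour -rev_nseq; congr (flatten (rev _)); elim: s => //= -[] s ->.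
  have flat1 : flatten (nseq (size s) [:: tick]) = nseq (size s) tick by elim: (size s) => //= i ->.
  apply/funext => k; rewrite /stadd flatE cats0.
  case: k => //=; try by elim: (size s).
  by rewrite flat1; elim: {flatE flat1} s => //= -[] s ->.
have blockE i : block (fun=> z) (nseq i tick) = power_word i.
  by rewrite /block map_nseq rev_nseq.
have commE i s : comm_st put [::] [::] [::] [::]
    (wcomm (power_word i ++ c ++ winv (power_word i)) d ++ [::]) (zip_st ([::], [::]) s)
    = zip_st ([::], wcomm (power_word i ++ c ++ winv (power_word i)) d) s.
  by rewrite cats0; apply/funext; case.
have outE (s : seq unit) : pmap (fun b : B => if b is inr (inr _) then Some tt else None)
    (map (iC M) s) = nseq (size s) tt by elim: s => //= x s ->.
split.
  case=> st [st1 /den_scatter[s]]; rewrite (scatE s) => -> [st2 /den_write_comm].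
  rewrite blockE commE => -> [st3 /starE[[x y] red ->] [st4 [/= + ->] [/= + ->]]].
  case: x red => // red _; case: y red => // red _ ->.
  by exists (size s); rewrite ?outE.
case=> i red ->; exists (zip_st ([::], [::]) (nseq i tt)); last first.
  by rewrite outE size_nseq.
exists (stadd (outpour g (nseq i tt)) (fun=> [::])); first by apply/den_scatter; exists (nseq i tt).
exists (zip_st ([::], wcomm (power_word i ++ c ++ winv (power_word i)) d) (nseq i tt)).
  by rewrite scatE size_nseq; apply/den_write_comm; rewrite blockE commE.
exists (zip_st ([::], [::]) (nseq i tt)); first by apply/starE; exists ([::], [::]).
by exists (zip_st ([::], [::]) (nseq i tt)).
Qed.

End Reduction.

(** * Listing the relators of G_I *)

Definition gen_a : letter 3 := (ord0, false).
Definition up (x : letter 2) : letter 3 := (lift ord0 x.1, x.2).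
Definition gen_1 : letter 2 := (ord0, false).
Definition gen_2 : letter 2 := (ord_max, false).

(* Spells the indicator function of F_l. *)
Definition word_F : seq (letter 3) :=
  let x := up gen_1 in [:: linv x; gen_a; x; gen_a; x; gen_a; linv x].

Definition relatorsG (RGamma : seq (letter 2) -> Prop) (I : nat -> Prop) (w : seq (letter 3)) :=
  [\/ w = [:: gen_a; gen_a],
      exists z, w = wcomm (map up z ++ [:: gen_a] ++ winv (map up z)) [:: gen_a],
      exists2 r, RGamma r & w = map up r
    | exists2 i, I i &
      w = wcomm (nseq i (up gen_2) ++ [:: up gen_1] ++ winv (nseq i (up gen_2))) word_F].

Lemma winv_up z : map up (winv z) = winv (map up z).
Proof. by rewrite /winv map_rev -!map_comp. Qed.

Lemma wpowN n (x : letter n) k : wpow x (- k)%R = winv (wpow x k).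
Proof.
have winv_nseq m (y : letter n) : winv (nseq m y) = nseq m (linv y).
  by rewrite /winv map_nseq rev_nseq.
by case: k => [[|m]|m] //; rewrite /wpow winv_nseq ?linvK.
Qed.

(** Brings the relators of Z wr Z to the shape that [guess] writes. *)
Lemma wreath_relatorE k :
  map up (wreath_relator k) =
  wcomm (wpow (up gen_2) k ++ [:: up gen_1] ++ winv (wpow (up gen_2) k)) [:: up gen_1].
Proof.
have upw : map up (wpow gen_2 k) = wpow (up gen_2) k.
  by case: k => m; rewrite /wpow map_nseq.
rewrite /wreath_relator -/gen_1 -/gen_2 wpowN /wcomm !map_cat !winv_up !map_cat /=.
by rewrite !winv_up !upw.
Qed.

Section Relators.
Context (M : machine unit) (RGamma : seq (letter 2) -> Prop).
Local Notation B := (sym (letter 3) M).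
Local Notation put := (@iC _ (letter 3) M).

(** A letter printed by the machine listing I is spelled as the generator s2, so that its unary
    output i turns into the exponent of s2 in t_i. *)
Definition spell (b : B) : seq (letter 3) :=
  match b with inr (inr l) => [:: l] | inr (inl _) => [:: up gen_2] | _ => [::] end.

Definition onZ (s : seq B) (k : key) : seq B :=
  match k with kZ1 | kZ2 | kZ3 | kZ4 => s | _ => [::] end.

Definition guess (T : finType) (f : T -> letter 3) (c d : seq (letter 3)) : prog key B :=
  Seq (scatter (fun t => onZ [:: put (f t)])) (write_comm spell put c d).

Definition relator_st (w : seq (letter 3)) : key -> seq B :=
  comm_st put [::] [::] [::] [::] w nop.

Lemma outpour_onZ (T : Type) (f : T -> B) s :
  outpour (fun t => onZ [:: f t]) s = onZ (rev (map f s)).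
Proof.
apply/funext => k; rewrite /outpour.
have nilE (r : seq T) : flatten (rev [seq [::] | _ <- r]) = [::] :> seq B.
  by elim: r => //= x r IHr; rewrite rev_cons -cats1 flatten_cat IHr.
have oneE (r : seq T) : flatten (rev [seq [:: f x] | x <- r]) = rev (map f r).
  by elim: r => //= x r IHr; rewrite !rev_cons -!cats1 flatten_cat IHr.
by case: k => /=; rewrite ?nilE ?oneE.
Qed.

Lemma den_guess (T : finType) (f : T -> letter 3) c d st :
  den (guess f c d) (fun=> [::]) st <->
  exists z, st = relator_st (wcomm (map f z ++ c ++ winv (map f z)) d).
Proof.
have stE z : stadd (outpour (fun t => onZ [:: put (f t)]) z) (fun=> [::]) =
    comm_st put (rev (map (put \o f) z)) (rev (map (put \o f) z)) (rev (map (put \o f) z))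
      (rev (map (put \o f) z)) [::] nop.
  by rewrite (outpour_onZ (put \o f)); apply/funext; case; rewrite /stadd /= ?cats0.
have blockE z : block spell (rev (map (put \o f) z)) = map f z.
  rewrite /block -map_rev revK -map_comp.
  by elim: z => //= x z ->.
split=> [[st1 /den_scatter[z ->]] | [z ->]].
  by rewrite stE => /den_write_comm->; exists z; rewrite blockE cats0.
exists (stadd (outpour (fun t => onZ [:: put (f t)]) z) (fun=> [::])).
  by apply/den_scatter; exists z.
by rewrite stE; apply/den_write_comm; rewrite blockE cats0.
Qed.

Definition lamp_relator_prog : prog key B :=
  Seq (mrun M) (Seq (drain kW (fun b => onZ [:: b])) (write_comm spell put [:: up gen_1] word_F)).

Lemma den_lamp_relator_prog I st : (forall w, lists M w <-> exists2 i, I i & w = nseq i tt) ->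
  den lamp_relator_prog (fun=> [::]) st <-> exists2 i, I i &
    st = relator_st (wcomm (nseq i (up gen_2) ++ [:: up gen_1] ++ winv (nseq i (up gen_2))) word_F).
Proof.
move=> listM.
have emptyE : (fun=> [::]) = cst [::] [::] [::] [::] [::] nop :> (key -> seq B).
  by apply/funext; case.
have drainE := computes_drain (g := fun b : B => onZ [:: b]) (j := kW) (fun=> erefl).
pose zs i : seq B := rev (map id (map (@iA _ _ M) (rev (nseq i tt)))).
have stE i : stadd (outpour (fun b : B => onZ [:: b]) (map (@iA _ _ M) (rev (nseq i tt))))
    (upd (cst [::] [::] [::] [::] (rev (nseq i tt)) nop) kW [::])
    = comm_st put (zs i) (zs i) (zs i) (zs i) [::] nop.
  by rewrite (outpour_onZ id); apply/funext; case; rewrite /stadd /= ?cats0.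
have blockE i : block spell (zs i) = nseq i (up gen_2).
  rewrite /block /zs map_id rev_nseq map_nseq rev_nseq map_nseq rev_nseq /=.
  by elim: i => //= i ->.
rewrite emptyE; split=> [[st1 /den_mrun[w /listM[i Ii ->] ->]] [st2 /drainE->] | [i Ii ->]].
  by rewrite stE => /den_write_comm->; exists i; rewrite // blockE cats0.
exists (cst [::] [::] [::] [::] (rev (nseq i tt)) nop).
  by apply/den_mrun; exists (nseq i tt) => //; apply/listM; exists i.
exists (comm_st put (zs i) (zs i) (zs i) (zs i) [::] nop); first by apply/drainE; rewrite stE.
by apply/den_write_comm; rewrite blockE cats0.
Qed.

Lemma relators_listable_with I (progGamma : prog key B) :
  (forall w, lists M w <-> exists2 i, I i & w = nseq i tt) ->
  (forall st, den progGamma (fun=> [::]) st <->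
     exists2 r, RGamma r & st = relator_st (map up r)) ->
  listable (relatorsG RGamma I).
Proof.
move=> listM denG.
pose aa : seq (letter 3) := [:: gen_a; gen_a].
have [N listN] := den_listable (Alt (rule nop (only kY (map put aa)))
  (Alt (guess up [:: gen_a] [:: gen_a]) (Alt progGamma lamp_relator_prog)))
  kY (fun b => if b is inr (inr l) then Some l else None).
exists N => w; apply: iff_trans (listN w) _.
have aaE : stadd (only kY (map put aa)) (fun=> [::]) = relator_st aa.
  by apply/funext; case.
have outE (v : seq (letter 3)) :
    pmap (fun b : B => if b is inr (inr l) then Some l else None) (relator_st v kY) = v.
  by rewrite /=; elim: v => //= x v ->.
split.
  case=> st + ->; case=> [/computes_push-> | [/den_guess[z ->] |
      [/denG[r Rr ->] | /(den_lamp_relator_prog _ listM)[i Ii ->]]]].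
  - by rewrite aaE outE; apply: Or41.
  - by rewrite outE; apply: Or42; exists z.
  - by rewrite outE; apply: Or43; exists r.
  - by rewrite outE; apply: Or44; exists i.
move=> Rw; exists (relator_st w); last by rewrite outE.
case: Rw => [-> | [z ->] | [r Rr ->] | [i Ii ->]].
- by left; apply/computes_push; rewrite aaE.
- by right; left; apply/den_guess; exists z.
- by right; right; left; apply/denG; exists r.
- by right; right; right; apply/(den_lamp_relator_prog _ listM); exists i.
Qed.

End Relators.

Lemma relators_listable_free I : recursively_enumerable I -> listable (relatorsG (fun=> False) I).
Proof.
case=> M listM; apply: (relators_listable_with (M := M) (progGamma := Fail)) => // st.
by split=> // -[].
Qed.

Lemma relators_listable_wreath I : recursively_enumerable I ->
  listable (relatorsG (fun r => exists k, r = wreath_relator k) I).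
Proof.
case=> M listM.
pose pw x := guess M (fun _ : unit => x) [:: up gen_1] [:: up gen_1].
(* Nonnegative and negative exponents k are guessed separately, as powers of s2 and of its
   inverse. *)
apply: (relators_listable_with (M := M) (progGamma := Alt (pw (up gen_2)) (pw (linv (up gen_2))))) => //.
have powE (s : seq unit) (x : letter 3) : map (fun=> x) s = nseq (size s) x.
  by elim: s => //= _ s ->.
move=> st; split.
  case=> /den_guess[s ->]; rewrite powE.
    by exists (wreath_relator (Posz (size s))); [exists (Posz (size s)) | rewrite wreath_relatorE].
  exists (wreath_relator (- Posz (size s))%R); first by exists (- Posz (size s))%R.
  rewrite wreath_relatorE; have -> // : wpow (up gen_2) (- Posz (size s))%R = nseq (size s) (linv (up gen_2)).
  by rewrite wpowN /= /winv map_nseq rev_nseq.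
case=> _ [[m|m] ->] ->; rewrite wreath_relatorE.
  by left; apply/den_guess; exists (nseq m tt); rewrite powE size_nseq.
by right; apply/den_guess; exists (nseq m.+1 tt); rewrite powE size_nseq.
Qed.

(** * Words and their values *)

Local Open Scope group_scope.

Lemma star_trans (T : Type) (R : T -> T -> Prop) x y z : star R x y -> star R y z -> star R x z.
Proof. by elim=> // {}x u v xu _ IH /IH; apply: starS. Qed.

Lemma star1 (T : Type) (R : T -> T -> Prop) x y : R x y -> star R x y.
Proof. by move=> xy; apply: starS xy (star0 _ _). Qed.

Lemma star_map (T S : Type) (R : T -> T -> Prop) (R' : S -> S -> Prop) (f : T -> S) x y :
  (forall u v, R u v -> star R' (f u) (f v)) -> star R x y -> star R' (f x) (f y).
Proof.
move=> RR'; elim=> [{}x|{}x u v /RR' xu _]; first exact: star0.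
exact: star_trans.
Qed.

Section WordValue.
Context {n : nat} {G : groupType} (s : n.-tuple G).

Lemma weval_nil : weval s [::] = 1.
Proof. exact: big_nil. Qed.

Lemma weval_cons x w : weval s (x :: w) = leval s x * weval s w.
Proof. exact: big_cons. Qed.

Lemma weval_cat u v : weval s (u ++ v) = weval s u * weval s v.
Proof. exact: big_cat. Qed.

Lemma weval1 x : weval s [:: x] = leval s x.
Proof. by rewrite weval_cons weval_nil mulg1. Qed.

Lemma leval_linv x : leval s (linv x) = (leval s x)^-1.
Proof. by case: x => i []; rewrite /leval //= invgK. Qed.

Lemma weval_winv w : weval s (winv w) = (weval s w)^-1.
Proof.
elim: w => [|x w IHw]; first by rewrite weval_nil invg1.
by rewrite -cat1s winv_cat weval_cat IHw weval1 weval_cons invgM leval_linv.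
Qed.

Lemma weval_wcomm u v : weval s (wcomm u v) = [~ weval s u, weval s v].
Proof. by rewrite /wcomm !weval_cat !weval_winv commgEl conjgE !mulgA. Qed.

Lemma weval_wcomm1 u v : weval s (wcomm u v) = 1 <-> commute (weval s u) (weval s v).
Proof. by rewrite weval_wcomm; split=> [/eqP/commgP | /commgP/eqP]. Qed.

Lemma weval_conj u v : weval s (u ++ v ++ winv u) = weval s u * weval s v * (weval s u)^-1.
Proof. by rewrite !weval_cat weval_winv mulgA. Qed.

Lemma weval_nseq i x : weval s (nseq i x) = leval s x ^+ i.
Proof. by elim: i => [|i IHi]; rewrite ?weval_nil //= weval_cons IHi expgS. Qed.

Lemma normal_closure_weval R w :
  (forall r, R r -> weval s r = 1) -> normal_closure R w -> weval s w = 1.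
Proof.
move=> R1; elim=> {w} [w /R1 //||u v _ u1 _ v1|w _ w1|u w _ w1|u v x _|u v x _].
- exact: weval_nil.
- by rewrite weval_cat u1 v1 mulg1.
- by rewrite weval_winv w1 invg1.
- by rewrite weval_conj w1 mulg1 mulgV.
- by rewrite !weval_cat !weval_cons leval_linv weval_nil mulg1 mulgV mul1g.
- by rewrite !weval_cat !weval_cons leval_linv weval_nil mulg1 mulgV mul1g.
Qed.

End WordValue.

Section WordProblem.
Context {n : nat} (R : seq (letter n) -> Prop).
Implicit Types u v w p : seq (letter n).

Inductive edit : seq (letter n) -> seq (letter n) -> Prop :=
| edit_pair u x v : edit (u ++ v) (u ++ [:: x; linv x] ++ v)
| edit_cancel u x v : edit (u ++ [:: x; linv x] ++ v) (u ++ v)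
| edit_rel u r v : R r -> edit (u ++ v) (u ++ r ++ v)
| edit_relV u r v : R r -> edit (u ++ v) (u ++ winv r ++ v).

Lemma edit_context u w w' v : star edit w w' -> star edit (u ++ w ++ v) (u ++ w' ++ v).
Proof.
apply: (star_map (f := fun w => u ++ w ++ v)) => {w w'} _ _ [u1 x v1|u1 x v1|u1 r v1 Rr|u1 r v1 Rr];
  rewrite -!catA !(catA u u1); apply: star1.
- exact: edit_pair.
- exact: edit_cancel.
- exact: edit_rel.
- exact: edit_relV.
Qed.

Lemma edit_winv w w' : star edit w w' -> star edit (winv w) (winv w').
Proof.
have winv_pair (x : letter n) : winv [:: x; linv x] = [:: x; linv x].
  by rewrite /winv /= /rev /= linvK.
apply: star_map => {w w'} _ _ [u x v|u x v|u r v Rr|u r v Rr];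
  rewrite !winv_cat ?winv_pair -?catA; apply: star1.
- exact: edit_pair.
- exact: edit_cancel.
- exact: edit_relV.
- by rewrite winvK; apply: edit_rel.
Qed.

Lemma edit_cancel_word u w v : star edit (u ++ w ++ winv w ++ v) (u ++ v).
Proof.
elim: w u v => [|x w IHw] u v; first exact: star0.
have -> : u ++ (x :: w) ++ winv (x :: w) ++ v = (u ++ [:: x]) ++ w ++ winv w ++ [:: linv x] ++ v.
  by rewrite -[x :: w]cat1s winv_cat -!catA.
apply: star_trans (IHw _ _) _; rewrite -catA.
exact: star1 (edit_cancel u x v).
Qed.

(** No move deletes a relator: it is removed by inserting its inverse behind it and cancelling.
    Conjugation and inversion need no moves of their own, since edits work in any context and [winv]
    maps edits to edits. *)
Lemma normal_closure_edit w : normal_closure R w -> star edit w [::].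
Proof.
elim=> {w} [w Rw||u v _ u0 _ v0|w _ w0|u w _ w0|u v x _ uv0|u v x _ uv0].
- have := edit_cancel_word [::] w [::]; rewrite /= cats0; apply: star_trans.
  by have := edit_relV w [::] Rw; rewrite !cats0; apply: star1.
- exact: star0.
- exact: star_trans (edit_context [::] v u0) v0.
- exact: edit_winv w0.
- apply: star_trans (edit_context u (winv u) w0) _.
  by have := edit_cancel_word [::] u [::]; rewrite /= cats0.
- exact: starS (edit_cancel u x v) uv0.
- exact: starS (edit_pair u x v) uv0.
Qed.

Lemma zip_rewind x y : star (zip_step R) (x, y) ([::], rev x ++ y).
Proof.
elim: x y => [|a x IHx] y; first exact: star0.
rewrite rev_cons cat_rcons; apply: starS (IHx _); exact: zip_back.
Qed.

Lemma zip_advance u x y : star (zip_step R) (x, u ++ y) (rev u ++ x, y).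
Proof.
elim: u x y => [|a u IHu] x y; first exact: star0.
rewrite rev_cons cat_rcons; apply: starS (IHu _ _); exact: zip_forth.
Qed.

Lemma zip_edit u v : edit u v -> star (zip_step R) ([::], u) ([::], v).
Proof.
have local w p q x : zip_step R (rev w ++ [::], p) (x ++ rev w ++ [::], q) ->
    star (zip_step R) ([::], w ++ p) ([::], w ++ rev x ++ q).
  move=> pq; apply: star_trans (zip_advance w [::] p) _.
  apply: starS pq _; have := zip_rewind (x ++ rev w ++ [::]) q.
  by rewrite cats0 rev_cat revK -catA.
case=> {u v} [u x v|u x v|u r v Rr|u r v Rr].
- by apply: (local u v ([:: x; linv x] ++ v) [::]); apply: zip_insert.
- by apply: (local u ([:: x; linv x] ++ v) v [::]); apply: zip_cancel.
- by apply: (local u v (r ++ v) [::]); apply: zip_relator.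
- by apply: (local u v v (map (@linv n) r)); apply: zip_relatorV.
Qed.

(** Each edit is performed by advancing the cursor, making one move and rewinding. Conversely the
    value of [rev x ++ y] is invariant under every move. *)
Lemma zip_reduction (G : groupType) (s : n.-tuple G) w : presents s R ->
  weval s w = 1 <-> star (zip_step R) ([::], w) ([::], [::]).
Proof.
move=> [_ sR].
have R1 r : R r -> weval s r = 1 by move=> Rr; apply/sR/nclosure_rel.
split=> [/sR/normal_closure_edit | red].
  suff IH u v : star edit u v -> star (zip_step R) ([::], u) ([::], v) by apply: IH.
  by apply: (star_map (f := pair [::])) => ? ?; apply: zip_edit.
suff IH (p q : seq (letter n) * seq (letter n)) : star (zip_step R) p q ->
    weval s (rev p.1 ++ p.2) = weval s (rev q.1 ++ q.2).
  by rewrite (IH _ _ red) weval_nil.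
elim=> // {}p {}q q' pq _ <-; case: pq => [a x y|a x y|a x y|a x y|r x y Rr|r x y Rr] /=.
- by rewrite rev_cons cat_rcons.
- by rewrite rev_cons cat_rcons.
- by rewrite !weval_cat !weval_cons leval_linv mulVKg.
- by rewrite !weval_cat !weval_cons leval_linv mulVKg.
- by rewrite !weval_cat (R1 r Rr) mul1g.
- by rewrite rev_cat -catA !weval_cat -/(winv r) weval_winv (R1 r Rr) invg1 mul1g.
Qed.

End WordProblem.

(** * The lamp action of Gamma *)

Section LampAction.

(* s1 turns the lamp counter (m, y) |-> (m, y + 1) at position m = 0, and s2
   shifts the positions. *)
Definition act (x : letter 2) (p : int * int) : int * int :=
  if x.1 == ord0 then
    (p.1, if p.1 == 0%R then (if x.2 then p.2 - 1 else p.2 + 1)%R else p.2)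
  else ((if x.2 then p.1 - 1 else p.1 + 1)%R, p.2).

Definition actw (w : seq (letter 2)) (p : int * int) := foldr act p w.

Lemma actw_cat u v p : actw (u ++ v) p = actw u (actw v p).
Proof. exact: foldr_cat. Qed.

Lemma act_linvK x p : act x (act (linv x) p) = p.
Proof.
case: x p => i b [m y]; rewrite /act /linv /=.
case: (i == ord0) => /=; last by case: b => /=; congr pair; lia.
by case: (m == 0%R); case: b => //=; congr pair; lia.
Qed.

Lemma actw_winvK w p : actw w (actw (winv w) p) = p.
Proof.
elim: w p => //= x w IHw p.
by rewrite -cat1s winv_cat actw_cat IHw act_linvK.
Qed.

Lemma normal_closure_act R w : (forall r p, R r -> actw r p = p) ->
  normal_closure R w -> forall p, actw w p = p.
Proof.
move=> R1; elim=> {w} [w /R1 //||u v _ u1 _ v1|w _ w1|u w _ w1|u v x _ uv1|u v x _ uv1] p.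
- by [].
- by rewrite actw_cat v1 u1.
- by rewrite -[LHS]w1 actw_winvK.
- by rewrite !actw_cat w1 actw_winvK.
- by rewrite !actw_cat /= act_linvK -actw_cat.
- by rewrite -[RHS]uv1 !actw_cat /= act_linvK.
Qed.

Lemma actw_pow2 k p : actw (wpow gen_2 k) p = ((p.1 + k)%R, p.2).
Proof.
case: p => m y; case: k => k; rewrite /wpow.
  elim: k => [|k IHk] /=; first by rewrite GRing.addr0.
  by rewrite -/(actw _ _) IHk /act /=; congr pair; lia.
have -> : Negz k = (- Posz k.+1)%R by [].
elim: k.+1 => [|i IHi] /=; first by rewrite GRing.subr0.
by rewrite -/(actw _ _) IHi /act /=; congr pair; lia.
Qed.

Lemma actw_lamp k p : actw (wpow gen_2 k ++ [:: gen_1] ++ winv (wpow gen_2 k)) p =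
  (p.1, if p.1 == k then p.2 + 1 else p.2)%R.
Proof.
rewrite !actw_cat -wpowN !actw_pow2 /= /act /=.
have -> : ((p.1 - k)%R == 0%R) = (p.1 == k) by apply/eqP/eqP; lia.
by case: eqP => _; congr pair; lia.
Qed.

(** Lamps at the positions k and 0 turn independently of each other, so the two elements in the
    commutator commute in the action. *)
Lemma wreath_relator_act k p : actw (wreath_relator k) p = p.
Proof.
have commw u v : (forall q, actw u (actw v q) = actw v (actw u q)) ->
    actw (wcomm u v) p = p.
  by move=> uv; rewrite /wcomm !actw_cat uv -[in X in actw _ (actw _ X)](winvK v)
    -{2}(winvK u) !actw_winvK.
rewrite /wreath_relator -/gen_1 -/gen_2 wpowN; apply: commw => -[m y].
rewrite !actw_lamp /= /act /=; case: (m == k); case: (m == 0%R) => //=; congr pair; lia.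
Qed.

End LampAction.

Section Faithful.
Context {Gamma : groupType} (s1 s2 : Gamma).
Hypothesis hGamma : is_free2 s1 s2 \/ is_ZwrZ s1 s2.
Local Notation gens := [tuple s1; s2].

Lemma leval_gen1 : leval gens gen_1 = s1.
Proof. by []. Qed.

Lemma leval_gen2 : leval gens gen_2 = s2.
Proof. by rewrite /leval /= (tnth_nth 1). Qed.

Lemma gens_generate g : exists w, weval gens w = g.
Proof. by case: hGamma => -[]. Qed.

Lemma weval1_act w p : weval gens w = 1 -> actw w p = p.
Proof.
(* The free group has no relators to check, so one action serves both cases. *)
case: hGamma => -[_ relE] /relE nw; apply: (normal_closure_act _ nw) => //.
by move=> r q [k ->]; apply: wreath_relator_act.
Qed.

Lemma weval_act u v p : weval gens u = weval gens v -> actw u p = actw v p.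
Proof.
move=> uv; have actVK q : actw (winv v) (actw v q) = q by rewrite -{2}(winvK v) actw_winvK.
rewrite -{1}(actVK p) -actw_cat weval1_act //.
by rewrite weval_cat weval_winv uv mulgV.
Qed.

Lemma weval_conj_gen n :
  weval gens (wpow gen_2 (Posz n) ++ [:: gen_1] ++ winv (wpow gen_2 (Posz n))) = conj_gen s1 s2 n.
Proof. by rewrite weval_conj weval_nseq weval1 leval_gen1 leval_gen2. Qed.

(** Each t_i with i in I moves only the counter at position i, hence fixes one at a position n
    outside I, and this passes to products and inverses. The word [w] is there because the action is
    defined on words. *)
Lemma Lambda_act I n g w y : Lambda s1 s2 I g -> ~ I n -> weval gens w = g ->
  actw w (Posz n, y) = (Posz n, y).
Proof.
move=> Lg nIn; elim: Lg w y => {g} [g [i Ii ->]||g h _ IHg _ IHh|g _ IHg] w y def_w.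
- rewrite (weval_act (v := wpow gen_2 (Posz i) ++ [:: gen_1] ++ winv (wpow gen_2 (Posz i)))).
    rewrite actw_lamp /=; case: eqP => // -[ni].
    by case: nIn; rewrite ni.
  by rewrite weval_conj_gen.
- exact: weval1_act.
- have [[u def_u] [v def_v]] := (gens_generate g, gens_generate h).
  rewrite (weval_act (v := u ++ v)); last by rewrite weval_cat def_u def_v.
  by rewrite actw_cat IHh // IHg.
- rewrite -{1}(IHg (winv w)) ?actw_winvK //.
  by rewrite weval_winv def_w invgK.
Qed.

Lemma Lambda_conj_gen I n : Lambda s1 s2 I (conj_gen s1 s2 n) -> I n.
Proof.
move=> Ln; apply: contrapT => nIn.
have := Lambda_act 0%R Ln nIn (weval_conj_gen n).
by rewrite actw_lamp eqxx.
Qed.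

Lemma s1_infinite_order n : s1 ^+ n = 1 -> n = 0.
Proof.
move=> s1n; have := @weval1_act (nseq n gen_1) (0%R, 0%R).
rewrite weval_nseq leval_gen1 => /(_ s1n).
suff -> : actw (nseq n gen_1) (0%R, 0%R) = (0%R, Posz n) by case.
by elim: {s1n} n => //= n IHn; rewrite -/(actw _ _) IHn /act /=; congr pair; lia.
Qed.

End Faithful.

(** * The subspace V *)

(** Finite sums over Z/2Z are handled as lists of points; a sum vanishes exactly when each point
    occurs evenly often. The induction removes two copies of one point. *)
Lemma even_count_ind (T : eqType) (P : seq T -> Prop) :
  P [::] -> (forall x l1 l2, P (l1 ++ l2) -> P (x :: l1 ++ x :: l2)) ->
  forall l, (forall x, ~~ odd (count_mem x l)) -> P l.
Proof.
move=> P0 P2 l; have [m] := ubnP (size l); elim: m l => // m IHm [|x l] //= lt_m even_l.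
have xl : x \in l.
  have := even_l x; rewrite eqxx /= negbK -has_pred1 has_count.
  by case: (count_mem x l).
case/splitPr: xl lt_m even_l => l1 l2 lt_m even_l; apply: P2; apply: IHm.
  by move: lt_m; rewrite !size_cat /=; lia.
move=> y; have := even_l y; rewrite !count_cat /=.
by case: (x == y); rewrite !oddD /= ?oddD //; case: (odd _); case: (odd _).
Qed.

Lemma natr_Z2_eq0 n : (n%:R == 0 :> 'Z_2)%R = ~~ odd n.
Proof. by rewrite -val_eqE /= Zp_nat /= modn2; case: (odd n). Qed.

Section Sums.
Context {Gamma : groupType}.
Implicit Types (g x : Gamma) (l : seq Gamma).

Definition dl l : {malg 'Z_2[Gamma]} := (\sum_(x <- l) << x >>)%R.

Lemma dl_coef l y : ((dl l)@_y = (count_mem y l)%:R)%R.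
Proof.
rewrite /dl; elim: l => [|x l IHl]; first by rewrite big_nil mcoeff0.
by rewrite big_cons mcoeffD IHl mcoeffU /= GRing.natrD.
Qed.

Lemma dl_cat l1 l2 : dl (l1 ++ l2) = (dl l1 + dl l2)%R.
Proof. exact: big_cat. Qed.

Lemma malg_oppZ2 (v : {malg 'Z_2[Gamma]}) : (- v = v)%R.
Proof.
apply/malgP => x; rewrite mcoeffN; case: (v@_x)%R => -[|[|i]] // lt_i.
  by apply: val_inj.
by apply: val_inj.
Qed.

Lemma dl_even l : dl l = 0%R -> forall x, ~~ odd (count_mem x l).
Proof. by move=> l0 x; rewrite -natr_Z2_eq0 -dl_coef l0 mcoeff0. Qed.

Lemma dl_eq_even l1 l2 : dl l1 = dl l2 -> forall x, ~~ odd (count_mem x (l1 ++ l2)).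
Proof.
by move=> l12; apply: dl_even; rewrite dl_cat l12 -{1}[dl l2]malg_oppZ2 GRing.addNr.
Qed.

Lemma Z2_case (c : 'Z_2) : c = 0%R \/ c = 1%R.
Proof. by case: c => -[|[|i]] // lt_i; [left | right]; apply: val_inj. Qed.

Lemma dl_onto (v : {malg 'Z_2[Gamma]}) : exists l, v = dl l.
Proof.
exists (msupp v); rewrite {1}[v]monalgE /dl; apply: eq_big_seq => x xv.
by case: (Z2_case v@_x) => [v0|->] //; rewrite -mcoeff_neq0 v0 eqxx in xv.
Qed.

Lemma translate_dl g l : translate g (dl l) = dl [seq g * x | x <- l].
Proof.
apply/malgP => x; rewrite translateE !dl_coef count_map; congr (_%:R)%R.
by apply: eq_count => y /=; rewrite -(inj_eq (mulgI g) y) mulVKg.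
Qed.

Section FlI.
Variables (s1 s2 : Gamma) (I : nat -> Prop).
Hypothesis s1_inf : forall n, s1 ^+ n = 1 -> n = 0.

(** Right convolution with the indicator of F_l, at the level of lists. Convolving [pairs] yields
    the sums of generators of V. *)
Definition fsum l := flatten [seq [:: g * s1^-1; g; g * s1] | g <- l].
Definition pairs (L : seq (Gamma * Gamma)) := flatten [seq [:: p.1; p.1 * p.2] | p <- L].

Lemma fsum_cat l1 l2 : fsum (l1 ++ l2) = fsum l1 ++ fsum l2.
Proof. by rewrite /fsum map_cat flatten_cat. Qed.

Lemma count_fsum x l :
  count_mem x (fsum l) = count_mem (x * s1) l + count_mem x l + count_mem (x * s1^-1) l.
Proof.
elim: l => //= g l IHl; rewrite IHl.
have e1 : (g * s1^-1 == x) = (g == x * s1) by rewrite divg_eq.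
have e2 : (g * s1 == x) = (g == x * s1^-1) by rewrite -divg_eq invgK.
rewrite e1 e2; lia.
Qed.

(** The points g s1^-1, g and g s1 must be distinct, as coinciding ones would cancel mod 2; this
    uses that s1 and its square are nontrivial. *)
Lemma indicator_F g : indicator (left_mul_set (Fl s1) g) = dl (fsum [:: g]).
Proof.
have s1_1 : s1 != 1 by apply/eqP => s1E; have := s1_inf (n := 1); rewrite expg1 => /(_ s1E).
have s1_2 : s1 * s1 != 1 by apply/eqP => s1E; have := s1_inf (n := 2); rewrite expg2 => /(_ s1E).
apply/malgP => x; rewrite indicatorE mem_left_mul_set dl_coef count_uniq_mem.
  congr (nat_of_bool _)%:R%R; rewrite /fsum /Fl /= !inE.
  by rewrite -!(inj_eq (mulgI g) (g^-1 * x)) mulVKg mulg1 -orbA.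
have eqM h : (g == g * h) = (h == 1) by rewrite -{1}[g]mulg1 (inj_eq (mulgI g)) eq_sym.
by rewrite /= !inE !negb_or andbT !divg_eq -mulgA !eqM s1_1 s1_2.
Qed.

Lemma V_FlI_list v : v \in V_FlI s1 s2 I ->
  exists2 L, (forall p, p \in L -> Lambda s1 s2 I p.2) & v = dl (fsum (pairs L)).
Proof.
move=> /V_FlIP[c [Lc ->]]; elim: c Lc => [|[c v'] S IHS] Lc.
  by exists [::]; rewrite // big_nil /dl big_nil.
have [x xS|L LL defv] := IHS; first by apply: Lc; rewrite in_cons xS orbT.
rewrite big_cons defv /=; have [/= g [t [Lt ->]]] := Lc _ (mem_head _ _).
case: (Z2_case c) => ->; first by exists L; rewrite // GRing.scale0r GRing.add0r.
exists ((g, t) :: L) => [x|]; first by rewrite in_cons => /predU1P[->|/LL].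
by rewrite GRing.scale1r malg_oppZ2 !indicator_F -!dl_cat -!fsum_cat.
Qed.

(** Along the ray x0 s1^k the list [l] eventually has no points. The count in [fsum l] at x0
    s1^(k+1) adds up the counts in [l] at the exponents k, k+1 and k+2, so evenness descends from
    large k to k = 0. *)
Lemma fsum_inj l : (forall x, ~~ odd (count_mem x (fsum l))) -> forall x, ~~ odd (count_mem x l).
Proof.
move=> even_l x0; apply/negP => odd_x0.
have s1_inj y : injective (fun k => y * s1 ^+ k).
  move=> i j /mulgI; wlog le_ij : i j / i <= j => [wl|sij].
    by case/orP: (leq_total i j) => ? ?; [apply: wl | apply/esym/wl].
  suff : j - i = 0 by lia.
  by apply: s1_inf; rewrite expgnFr // -sij mulgV.
have [N lN] : exists N, forall k, N <= k -> x0 * s1 ^+ k \notin l.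
  elim: {even_l odd_x0} l => [|y l [N lN]]; first by exists 0.
  have [[k xk]|no_k] := pselect (exists k, x0 * s1 ^+ k = y); last first.
    exists N => k /lN lk; rewrite in_cons negb_or lk andbT.
    by apply/eqP => xk; apply: no_k; exists k.
  exists (maxn N k.+1) => j; rewrite geq_max => /andP[/lN lj lt_kj].
  rewrite in_cons negb_or lj andbT -xk (inj_eq (s1_inj x0)); lia.
have {}lN k : N <= k -> ~~ odd (count_mem (x0 * s1 ^+ k) l).
  by move=> /lN; rewrite -has_pred1 has_count -eqn0Ngt => /eqP->.
(* The recurrence has order two, so two consecutive counts are carried along. *)
suff down j : j <= N -> ~~ odd (count_mem (x0 * s1 ^+ (N - j)) l)
    /\ ~~ odd (count_mem (x0 * s1 ^+ (N - j).+1) l).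
  by have [] := down N (leqnn N); rewrite subnn mulg1 odd_x0.
elim: j => [_|j IHj lt_jN]; first by rewrite subn0; split; apply: lN.
have [] := IHj (ltnW lt_jN); have -> : N - j = (N - j.+1).+1 by lia.
set k := N - j.+1 => c1 c2; split=> //.
have := even_l (x0 * s1 ^+ k.+1); rewrite count_fsum !oddD.
rewrite {3}expgSr -!mulgA -expgSr mulgV mulg1.
by rewrite (negPf c1) (negPf c2).
Qed.

Lemma even_count (p : pred Gamma) l : (forall x, ~~ odd (count_mem x l)) -> ~~ odd (count p l).
Proof.
elim/even_count_ind: l / => // x l1 l2; rewrite /= !count_cat /= !oddD.
by case: (p x) => /=; case: (odd _); case: (odd _).
Qed.

Lemma Lambda_of_V t :
  (indicator (left_mul_set (Fl s1) 1) - indicator (left_mul_set (Fl s1) t))%R \in V_FlI s1 s2 I ->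
  Lambda s1 s2 I t.
Proof.
move=> /V_FlI_list[L LL]; rewrite malg_oppZ2 !indicator_F -dl_cat -fsum_cat.
move=> /dl_eq_even; rewrite -fsum_cat => /fsum_inj/(even_count (fun x => `[< Lambda s1 s2 I x >])).
rewrite count_cat oddD.
have -> : odd (count (fun x => `[< Lambda s1 s2 I x >]) (pairs L)) = false.
  elim: L LL => //= [[g t'] L] IHL LL.
  rewrite !oddD IHL => [|x xL]; last by apply: LL; rewrite in_cons xL orbT.
  have Lt' : Lambda s1 s2 I t' by apply: (LL (g, t')); rewrite mem_head.
  have -> : `[< Lambda s1 s2 I (g * t') >] = `[< Lambda s1 s2 I g >].
    apply: asbool_equiv_eq; split=> [Lgt|Lg]; last exact: generated_mul.
    by rewrite -[g](mulgK t'); apply: generated_mul => //; apply: generated_inv.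
  by case: (asboolP (Lambda s1 s2 I g)).
rewrite /= (asboolT (generated_1 _)).
by case: (asboolP (Lambda s1 s2 I t)).
Qed.

End FlI.
End Sums.

(** * From a presentation of G_I to an enumeration of I *)

Local Open Scope quotient_scope.

Section GIElements.
Context {Gamma : groupType} (s1 s2 : Gamma) (I : nat -> Prop).
Hypothesis hGamma : is_free2 s1 s2 \/ is_ZwrZ s1 s2.
Local Notation G := (GI s1 s2 I).
Local Notation V := (V_FlI s1 s2 I).
Implicit Types (g h t : Gamma) (u v : {malg 'Z_2[Gamma]}).

Definition pt v g : G := (\pi_(Quotient.quot V) v, g).

Lemma pt_mul u v g h : pt u g * pt v h = pt (u + translate g v)%R (g * h).
Proof.
by rewrite /pt; congr pair; rewrite /= Vquot_act_pi -GRing.raddfD.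
Qed.

Lemma pt_surj (p : G) : exists v g, p = pt v g.
Proof. by case: p => a g; exists (repr a), g; rewrite /pt reprK. Qed.

Lemma pt_eq u v g h : pt u g = pt v h <-> (u - v)%R \in V /\ g = h.
Proof.
rewrite /pt Quotient.idealrBE; split=> [[uv ->]|[/eqP uv ->]]; last by rewrite uv.
by split=> //; apply/eqP.
Qed.

Lemma pt1 : pt 0%R 1 = 1.
Proof. by rewrite /pt GRing.raddf0. Qed.

Definition emb g : G := pt 0%R g.

Lemma embM g h : emb (g * h) = emb g * emb h.
Proof. by rewrite /emb pt_mul translate0 GRing.addr0. Qed.

Lemma embV g : emb g^-1 = (emb g)^-1.
Proof. by apply/esym/mulg1_eq; rewrite -embM mulgV; apply: pt1. Qed.

Lemma embX g n : emb (g ^+ n) = emb g ^+ n.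
Proof. by elim: n => [|n IHn]; [apply: pt1 | rewrite !expgS embM IHn]. Qed.

Definition indF : G := pt (indicator (Fl s1)) 1.

Lemma left_mul_set1 X : left_mul_set X (1 : Gamma) = X.
Proof. by apply/fsetP => x; rewrite mem_left_mul_set invg1 mul1g. Qed.

Lemma commute_indF t : commute (emb t) indF <-> Lambda s1 s2 I t.
Proof.
have -> : commute (emb t) indF <->
    (indicator (left_mul_set (Fl s1) 1) - indicator (left_mul_set (Fl s1) t))%R \in V.
  rewrite /commute /emb /indF !pt_mul translate0 translate_indicator GRing.addr0 GRing.add0r.
  rewrite mul1g mulg1 left_mul_set1; split=> [/esym/pt_eq[] // | Vt].
  by apply/esym/pt_eq.
split; first exact: (Lambda_of_V (s1_infinite_order hGamma)).
move=> Lt; set v := (_ - _)%R; apply/V_FlIP; exists [:: (1%R, v)]; split=> [p|].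
  by rewrite mem_seq1 => /eqP-> /=; exists 1, t; split; rewrite // mul1g.
by rewrite big_seq1 GRing.scale1r.
Qed.

Lemma commute_conj_gen n : commute (emb s2 ^+ n * emb s1 * emb s2 ^- n) indF <-> I n.
Proof.
rewrite -embX -embV -!embM -/(conj_gen s1 s2 n) commute_indF.
split=> [|In]; first exact: Lambda_conj_gen.
by apply: generated_in; exists n.
Qed.

Theorem enumerable_of_presented : recursively_presented G -> recursively_enumerable I.
Proof.
move=> [n [s [R [[M listM] sR]]]].
have sM : presents s (lists M).
  case: sR => gen rel; split=> // w; rewrite rel.
  suff -> : lists M = R by [].
  by apply/funext => r; apply/propext.
have [gen _] := sR.
(* The given generating tuple is arbitrary; one fixed word for each of s2, s1 and b makes the tested
   words uniform in i. *)
have [[[z def_z] [c def_c]] [d def_d]] := (gen (emb s2), gen (emb s1), gen indF).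
have [N listN] := reduction_listable M c z d.
exists N => w; apply: iff_trans (listN w) _.
have IE i : star (zip_step (lists M)) ([::], wcomm (power_word z i ++ c ++ winv (power_word z i)) d)
    ([::], [::]) <-> I i.
  rewrite -(zip_reduction _ sM) weval_wcomm1 weval_conj def_c def_d.
  have -> : weval s (power_word z i) = emb s2 ^+ i.
    rewrite /power_word; elim: i => [|i IHi]; first exact: weval_nil.
    by rewrite /= weval_cat IHi def_z expgS.
  exact: commute_conj_gen.
by split=> -[i /IE Ii ->]; exists i.
Qed.

End GIElements.

(** * The group of a presentation *)

Section PresentedGroup.
Context {n : nat} (R : seq (letter n) -> Prop).
Implicit Types u v w : seq (letter n).

Lemma nclosure_cancel_word u v w :
  normal_closure R (u ++ winv v ++ v ++ w) -> normal_closure R (u ++ w).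
Proof.
elim: v u w => [|x v IHv] u w //; rewrite -cat1s winv_cat -!catA => nc.
apply: (IHv u w); have := @nclosure_cancel _ R (u ++ winv v) (v ++ w) (linv x).
by rewrite linvK -!catA; apply.
Qed.

(** Equality in the group presented by [R]. In the quotient, manipulations of normal closures become
    equations in a group, which is how the relators of G_I are shown to be complete. *)
Definition wrel u v : bool := `[< normal_closure R (u ++ winv v) >].

Lemma wrel_refl : reflexive wrel.
Proof. by move=> u; apply/asboolP/(nclosure_conj u (nclosure_nil R)). Qed.

Lemma wrel_sym : symmetric wrel.
Proof.
by move=> u v; apply/asboolP/asboolP => /nclosure_inv; rewrite winv_cat winvK.
Qed.

Lemma wrel_trans : transitive wrel.
Proof.
move=> v u w /asboolP uv /asboolP vw; apply/asboolP.
by apply: (nclosure_cancel_word (v := v)); rewrite catA; apply: nclosure_cat.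
Qed.

Lemma wrel_cat u u' v v' : wrel u u' -> wrel v v' -> wrel (u ++ v) (u' ++ v').
Proof.
move=> /asboolP uu' /asboolP vv'; apply/asboolP.
(* The product of u (v v'^-1) u^-1 and u u'^-1, in which u^-1 u is then cancelled. *)
have := nclosure_cat (nclosure_conj u vv') uu'; rewrite winv_cat -!catA => nc.
have -> : u ++ v ++ winv v' ++ winv u' = (u ++ v ++ winv v') ++ winv u' by rewrite -!catA.
by apply: (nclosure_cancel_word (v := u)); rewrite -!catA.
Qed.

Lemma wrel_winv u u' : wrel u u' -> wrel (winv u) (winv u').
Proof.
rewrite wrel_sym => /asboolP uu'; apply/asboolP; rewrite winvK.
rewrite -[winv u ++ u']cats0; apply: (nclosure_cancel_word (v := u)).
by have := nclosure_conj (winv u) uu'; rewrite winvK cats0 -!catA.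
Qed.

Canonical wrel_equiv := EquivRel wrel wrel_refl wrel_sym wrel_trans.

Definition pgroup := {eq_quot wrel_equiv}.
HB.instance Definition _ := EqQuotient.on pgroup.
HB.instance Definition _ := Choice.on pgroup.

Definition cls w : pgroup := \pi_pgroup w.

Lemma cls_eq u v : cls u = cls v <-> normal_closure R (u ++ winv v).
Proof.
by split=> [/eqP | /asboolP uv]; [rewrite eqmodE => /asboolP | apply/eqP; rewrite eqmodE].
Qed.

Definition pmul (p q : pgroup) : pgroup := cls (repr p ++ repr q).
Definition pinv (p : pgroup) : pgroup := cls (winv (repr p)).

Lemma repr_cls w : wrel (repr (cls w)) w.
Proof. by apply/asboolP/cls_eq; rewrite /cls reprK. Qed.

Lemma pmulE u v : pmul (cls u) (cls v) = cls (u ++ v).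
Proof. by apply/cls_eq/asboolP; apply: wrel_cat; apply: repr_cls. Qed.

Lemma pinvE u : pinv (cls u) = cls (winv u).
Proof. by apply/cls_eq/asboolP; apply: wrel_winv; apply: repr_cls. Qed.

Lemma cls_surj p : exists w, p = cls w.
Proof. by exists (repr p); rewrite /cls reprK. Qed.

Lemma pmulA : associative pmul.
Proof.
move=> p q r; have [[[u ->] [v ->]] [w ->]] := (cls_surj p, cls_surj q, cls_surj r).
by rewrite !pmulE catA.
Qed.

Lemma pmul1 : left_id (cls [::]) pmul.
Proof. by move=> p; have [u ->] := cls_surj p; rewrite pmulE. Qed.

Lemma pmulr1 : right_id (cls [::]) pmul.
Proof. by move=> p; have [u ->] := cls_surj p; rewrite pmulE cats0. Qed.

Lemma pmulrV : right_inverse (cls [::]) pinv pmul.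
Proof.
move=> p; have [u ->] := cls_surj p; rewrite pinvE pmulE; apply/cls_eq.
by rewrite cats0; apply: (nclosure_conj u (nclosure_nil R)).
Qed.

Lemma pmulV : left_inverse (cls [::]) pinv pmul.
Proof.
move=> p; have [u ->] := cls_surj p; have := pmulrV (cls (winv u)).
by rewrite !pinvE winvK.
Qed.

HB.instance Definition _ := isGroup.Build pgroup pmulA pmul1 pmulr1 pmulV pmulrV.

Lemma cls_cat u v : cls (u ++ v) = cls u * cls v.
Proof. exact/esym/pmulE. Qed.

Lemma cls_winv u : cls (winv u) = (cls u)^-1.
Proof. exact/esym/pinvE. Qed.

Lemma cls_eq1 w : cls w = 1 <-> normal_closure R w.
Proof. by rewrite -[1]/(cls [::]) cls_eq cats0. Qed.

Lemma cls_wcomm u v : cls (wcomm u v) = [~ cls u, cls v].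
Proof. by rewrite /wcomm !cls_cat !cls_winv commgEl conjgE !mulgA. Qed.

End PresentedGroup.

(** * A presentation of G_I *)

Section Presentation.
Context {Gamma : groupType} (s1 s2 : Gamma) (I : nat -> Prop).
Hypothesis hGamma : is_free2 s1 s2 \/ is_ZwrZ s1 s2.
Context (RGamma : seq (letter 2) -> Prop).
Local Notation gens := [tuple s1; s2].
Hypothesis presG : presents gens RGamma.
Local Notation G := (GI s1 s2 I).
Local Notation Rel := (relatorsG RGamma I).

Definition lamp (x : Gamma) : G := pt s1 s2 I (dl [:: x]) 1.
Local Notation emb := (emb s1 s2 I).

Definition gensG : 3.-tuple G := [tuple lamp 1; emb s1; emb s2].

Lemma leval_a b : leval gensG (ord0, b) = if b then (lamp 1)^-1 else lamp 1.
Proof. by []. Qed.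

Lemma leval_up x : leval gensG (up x) = emb (leval gens x).
Proof.
have tnthE (i : 'I_2) : tnth gensG (lift ord0 i) = emb (tnth gens i).
  by case: i => -[|[|i]] // lt_i; rewrite !(tnth_nth 1).
by rewrite /leval /= tnthE; case: x.2; rewrite ?embV.
Qed.

Lemma weval_up w : weval gensG (map up w) = emb (weval gens w).
Proof.
elim: w => [|x w IHw]; first by rewrite !weval_nil; apply/esym/pt1.
by rewrite /= !weval_cons IHw leval_up embM.
Qed.

Lemma emb_conj g x : emb g * lamp x * (emb g)^-1 = lamp (g * x).
Proof.
rewrite -embV /emb /lamp !pt_mul !translate0 GRing.add0r GRing.addr0 mulg1 mulgV.
by rewrite translate_dl.
Qed.

Lemma pt_commute u v : commute (pt s1 s2 I u 1) (pt s1 s2 I v 1).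
Proof. by rewrite /commute !pt_mul !translate1 GRing.addrC. Qed.

Lemma lamp_sqr x : lamp x * lamp x = 1.
Proof. by rewrite /lamp pt_mul translate1 -{1}[dl _]malg_oppZ2 GRing.addNr mulg1; apply: pt1. Qed.

(** The word groups as s1^-1 a s1, a, s1 a s1^-1: the lamps at the three points of F_l. *)
Lemma weval_word_F : weval gensG word_F = indF s1 s2 I.
Proof.
rewrite /word_F !weval_cons weval_nil !leval_linv leval_a leval_up leval_gen1.
have := emb_conj s1^-1 1; rewrite embV invgK mulg1 => lampV.
have := emb_conj s1 1; rewrite mulg1 => lamp1; rewrite mulg1.
rewrite !mulgA lampV -mulgA -mulgA (mulgA (emb s1)) lamp1 /lamp !pt_mul !mulg1 !translate1.
rewrite -!dl_cat /indF -[Fl s1]left_mul_set1 (indicator_F (s1_infinite_order hGamma)).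
by rewrite /fsum /= !mul1g.
Qed.

Lemma weval_lamp_word i :
  weval gensG (nseq i (up gen_2) ++ [:: up gen_1] ++ winv (nseq i (up gen_2)))
  = emb s2 ^+ i * emb s1 * emb s2 ^- i.
Proof. by rewrite weval_conj weval_nseq weval1 !leval_up leval_gen1 leval_gen2. Qed.

Lemma relatorsG_weval r : Rel r -> weval gensG r = 1.
Proof.
case=> [-> | [z ->] | [r' Rr' ->] | [i Ii ->]].
- by rewrite !weval_cons weval_nil mulg1 leval_a lamp_sqr.
- apply/weval_wcomm1; rewrite weval_conj weval_up weval1 leval_a emb_conj.
  exact: pt_commute.
- rewrite weval_up; have [_ rel] := presG.
  by rewrite (iffRL (rel _) (nclosure_rel Rr')); apply: pt1.
- apply/weval_wcomm1; rewrite weval_lamp_word weval_word_F.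
  exact/commute_conj_gen.
Qed.

Lemma gensG_generate p : exists w, weval gensG w = p.
Proof.
have [v [g ->]] := pt_surj p; have [l ->] := dl_onto v; have [genG _] := presG.
elim: l => [|x l [w def_w]].
  have [w def_w] := genG g; exists (map up w).
  by rewrite weval_up def_w /dl big_nil.
have [z def_z] := genG x.
exists ((map up z ++ [:: gen_a] ++ winv (map up z)) ++ w).
rewrite weval_cat weval_conj weval_up def_z weval1 leval_a emb_conj mulg1 def_w /lamp.
by rewrite pt_mul translate1 mul1g -dl_cat.
Qed.

Local Notation P := (pgroup Rel).
Local Notation cls := (@cls 3 Rel).

Lemma cls_rel r : Rel r -> cls r = 1.
Proof. by move=> Rr; apply/cls_eq1/nclosure_rel. Qed.

Lemma cls_up1 w : weval gens w = 1 -> cls (map up w) = 1.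
Proof.
have [_ rel] := presG => /rel nw; apply/cls_eq1.
elim: nw => {w} [w Rw||u v _ nu _ nv|w _ nw|u w _ nw|u v x _ nuv|u v x _ nuv].
- by apply: nclosure_rel; apply: Or43; exists w.
- exact: nclosure_nil.
- by rewrite map_cat; apply: nclosure_cat.
- by rewrite winv_up; apply: nclosure_inv.
- by rewrite !map_cat winv_up; apply: nclosure_conj.
- by rewrite !map_cat; apply: (@nclosure_insert _ Rel _ _ (up x)); rewrite -map_cat.
- by rewrite map_cat; apply: (@nclosure_cancel _ Rel _ _ (up x)); rewrite !map_cat in nuv.
Qed.

Definition word_of (g : Gamma) : seq (letter 2) := projT1 (cid (gens_generate hGamma g)).

Lemma word_ofK g : weval gens (word_of g) = g.
Proof. by rewrite /word_of; case: cid. Qed.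

(** The homomorphism from Gamma to the presented group; the chosen word does not matter, by
    [cls_up1]. *)
Definition lift_gamma (g : Gamma) : P := cls (map up (word_of g)).
Local Notation psi := lift_gamma.

Lemma psi_weval w : psi (weval gens w) = cls (map up w).
Proof.
apply/divg1_eq; rewrite /psi -cls_winv -cls_cat -winv_up -map_cat; apply: cls_up1.
by rewrite weval_cat weval_winv word_ofK mulgV.
Qed.

Lemma psiM g h : psi (g * h) = psi g * psi h.
Proof.
rewrite -{1}(word_ofK g) -{1}(word_ofK h) -weval_cat psi_weval.
by rewrite map_cat cls_cat.
Qed.

Lemma psi1 : psi 1 = 1.
Proof. by rewrite -(weval_nil gens) psi_weval. Qed.

Lemma psiV g : psi g^-1 = (psi g)^-1.
Proof. by apply/esym/mulg1_eq; rewrite -psiM mulgV psi1. Qed.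

Definition plamp (x : Gamma) : P := psi x * cls [:: gen_a] * (psi x)^-1.

Lemma plamp_sqr x : plamp x * plamp x = 1.
Proof.
have aa : cls [:: gen_a] * cls [:: gen_a] = 1.
  by rewrite -cls_cat; apply: cls_rel; apply: Or41.
by rewrite /plamp !mulgA mulgVK -(mulgA (psi x)) aa mulg1 mulgV.
Qed.

Lemma psi_plamp g x : psi g * plamp x * (psi g)^-1 = plamp (g * x).
Proof. by rewrite /plamp psiM invgM !mulgA. Qed.

(** The relators only make each lamp commute with the lamp at 1; conjugation by [psi y] carries the
    pair y^-1 x, 1 to x, y. *)
Lemma plamp_commute x y : commute (plamp x) (plamp y).
Proof.
have c1 z : commute (plamp z) (plamp 1).
  have := cls_rel (Or42 _ _ _ (ex_intro _ (word_of z) erefl)).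
  rewrite cls_wcomm !cls_cat cls_winv mulgA -[cls (map up _)]/(psi z) => /eqP/commgP.
  by rewrite {2}/plamp psi1 invg1 mulg1 mul1g.
have := c1 (y^-1 * x); rewrite -(mulVg y) -!psi_plamp psiV invgK => c.
move/(congr1 (fun p => psi y * p * (psi y)^-1)): c.
by rewrite !mulgA !mulgV !mul1g !mulgK /commute /plamp !mulgA.
Qed.

Definition plamps (l : seq Gamma) : P := \prod_(x <- l) plamp x.

Lemma plamps_cat l1 l2 : plamps (l1 ++ l2) = plamps l1 * plamps l2.
Proof. exact: big_cat. Qed.

Lemma plamps_cons x l : plamps (x :: l) = plamp x * plamps l.
Proof. exact: big_cons. Qed.

Lemma plamps_commute x l : commute (plamp x) (plamps l).
Proof. by apply: commute_prod => y _; apply: plamp_commute. Qed.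

(** Hence [plamps l] depends only on the sum [dl l]: lamps commute and have trivial squares. *)
Lemma plamps_even l : (forall x, ~~ odd (count_mem x l)) -> plamps l = 1.
Proof.
elim/even_count_ind: l / => [|x l1 l2]; first by rewrite /plamps big_nil.
rewrite plamps_cons !plamps_cat plamps_cons => l12.
by rewrite mulgA (plamps_commute x l1) -mulgA (mulgA (plamp x)) plamp_sqr mul1g.
Qed.

Lemma psi_plamps g l : psi g * plamps l * (psi g)^-1 = plamps [seq g * x | x <- l].
Proof.
elim: l => [|x l IHl]; first by rewrite /plamps !big_nil mulg1 mulgV.
by rewrite /= !plamps_cons -IHl -psi_plamp !mulgA mulgVK.
Qed.

(** The same [l] and [g] describe [w] in the presented group and in G_I, so triviality of the value
    can be transported between the two. *)
Lemma cls_normal_form w : exists l g,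
  cls w = plamps l * psi g /\ weval gensG w = pt s1 s2 I (dl l) g.
Proof.
elim: w => [|[i b] w [l [g [clsw evw]]]].
  exists [::], 1; rewrite psi1 weval_nil /plamps /dl !big_nil mulg1.
  by split=> //; rewrite pt1.
rewrite -cat1s cls_cat clsw weval_cons evw.
case: (unliftP ord0 i) => [j|] ->.
  pose x : letter 2 := (j, b); exists [seq leval gens x * y | y <- l], (leval gens x * g).
  have -> : cls [:: (lift ord0 j, b)] = psi (leval gens x).
    by rewrite -[leval gens x](weval1 gens) psi_weval.
  split; first by rewrite -psi_plamps psiM !mulgA mulgVK.
  by rewrite -[(lift ord0 j, b)]/(up x) leval_up pt_mul translate_dl GRing.add0r.
exists (1 :: l), g; rewrite plamps_cons leval_a.
have -> : plamp 1 = cls [:: gen_a] by rewrite /plamp psi1 mul1g invg1 mulg1.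
have -> : (if b then (lamp 1)^-1 else lamp 1) = lamp 1.
  by case: b => //; apply: mulg1_eq; apply: lamp_sqr.
have -> : cls [:: (ord0, b)] = cls [:: gen_a].
  case: b => //; rewrite -[[:: (ord0, true)]]/(winv [:: gen_a]) cls_winv.
  by apply: mulg1_eq; rewrite -cls_cat; apply: cls_rel; apply: Or41.
by rewrite mulgA /lamp pt_mul translate1 mul1g -dl_cat.
Qed.

Lemma plamps_fsum g : plamps (fsum s1 [:: g]) = psi g * cls word_F * (psi g)^-1.
Proof.
have <- : plamps [:: s1^-1; 1; s1] = cls word_F.
  have psi_s1 : psi s1 = cls [:: up gen_1].
    by rewrite -[s1](leval_gen1 s1 s2) -(weval1 [tuple s1; s2]) psi_weval.
  rewrite !plamps_cons /plamps big_nil mulg1 /plamp psi1 invg1 mul1g mulg1 psiV invgK.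
  have -> : word_F = winv [:: up gen_1] ++ [:: gen_a] ++ [:: up gen_1] ++ [:: gen_a]
    ++ [:: up gen_1] ++ [:: gen_a] ++ winv [:: up gen_1] by [].
  by rewrite !cls_cat cls_winv psi_s1 !mulgA.
by rewrite psi_plamps /fsum /= mulg1.
Qed.

Lemma Lambda_commute t : Lambda s1 s2 I t -> commute (psi t) (cls word_F).
Proof.
elim=> {t} [t [i Ii ->]||g h _ cg _ ch|g _ cg].
- rewrite -weval_conj_gen psi_weval; apply/commgP/eqP; rewrite -cls_wcomm.
  apply: cls_rel; apply: Or44; exists i => //.
  by rewrite !map_cat winv_up /wpow map_nseq.
- by rewrite psi1; apply/commute_sym/commute1.
- by rewrite psiM; apply/commute_sym/commuteM; apply/commute_sym.
- by rewrite psiV; apply/commute_sym/commuteV/commute_sym.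
Qed.

(** Conjugating b by [psi g] and by [psi (g * t)] gives the same element because t commutes with b;
    so both halves of a pair have the same product of lamps, and its square is trivial. *)
Lemma plamps_pairs L : (forall p, p \in L -> Lambda s1 s2 I p.2) -> plamps (fsum s1 (pairs L)) = 1.
Proof.
elim: L => [|[g t] L IHL] LL; first by rewrite /plamps big_nil.
have -> : fsum s1 (pairs ((g, t) :: L)) = fsum s1 [:: g] ++ fsum s1 [:: g * t] ++ fsum s1 (pairs L) by [].
rewrite plamps_cat (plamps_cat (fsum s1 [:: g * t])) IHL => [|p pL]; last by apply: LL; rewrite in_cons pL orbT.
have -> : plamps (fsum s1 [:: g * t]) = plamps (fsum s1 [:: g]).
  rewrite !plamps_fsum psiM invgM; have Lt := Lambda_commute (LL _ (mem_head _ _)).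
  by rewrite !mulgA -(mulgA (psi g)) Lt !mulgA mulgK.
have even_F x : ~~ odd (count_mem x (fsum s1 [:: g] ++ fsum s1 [:: g])).
  by rewrite count_cat addnn odd_double.
by have := plamps_even even_F; rewrite plamps_cat mulg1.
Qed.

(** A trivial value forces g = 1 and puts [dl l] into V, and elements of V become trivial in the
    presented group by [plamps_pairs]. *)
Lemma weval1_normal_closure w : weval gensG w = 1 -> normal_closure Rel w.
Proof.
move=> evw; apply/cls_eq1; have [l [g [-> def_w]]] := cls_normal_form w.
move: evw; rewrite def_w -pt1 => /pt_eq[]; rewrite GRing.subr0 => /(V_FlI_list (s1_infinite_order hGamma)).
move=> [L LL /dl_eq_even even_l] ->.
by have := plamps_even even_l; rewrite plamps_cat plamps_pairs // psi1 => ->.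
Qed.

Lemma presents_GI : presents gensG Rel.
Proof.
split=> [p | w]; first exact: gensG_generate.
split; first exact: weval1_normal_closure.
by apply: normal_closure_weval; apply: relatorsG_weval.
Qed.

End Presentation.

Theorem theorem12p3 (Gamma : groupType) (s1 s2 : Gamma)
    (hGamma : is_free2 s1 s2 \/ is_ZwrZ s1 s2)
    (I : nat -> Prop) (hI : forall i : nat, I i -> (0 < i)%N) :
  recursively_presented (GI s1 s2 I) <-> recursively_enumerable I.
Proof.
split; first exact: enumerable_of_presented.
move=> reI; case: (hGamma) => presG; exists 3, (gensG s1 s2 I); eexists; split.
- exact: relators_listable_free reI.
- exact: (presents_GI I hGamma presG).
- exact: relators_listable_wreath reI.
- exact: (presents_GI I hGamma presG).
Qed.
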